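(* Let $k>1$ be an integer and let $g:\mathbb{R}^n\times\mathbb{R}^m\to\mathbb{R}$ be a semi-algebraic function of class $C^k$. Write $g_x:=g(x,\cdot)$. Assume that $g$ is parametric Morse and that the set-valued map $x\rightrightarrows\operatorname{crit}g_x$ has non-empty values and is locally bounded. Then there exist integers $M\ge N\ge0$ and $M$ semi-algebraic $C^{k-1}$ functions $y^{(1)},\dots,y^{(N)},\dots,y^{(M)}:\mathbb{R}^n\to\mathbb{R}^m$, with distinct values at each point (i.e. $y^{(i)}(x)\ne y^{(j)}(x)$ for all $x$ and $i\neq j$), such that $$\{(x,y): y\in\operatorname{crit}g_x\}=\bigcup_{i=1}^M\operatorname{graph}y^{(i)},\qquad \{(x,y): y\text{ is a local minimizer of }g_x\}=\bigcup_{i=1}^N\operatorname{graph}y^{(i)},$$ where the union is empty if $N=0$ or $M=0$.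
   Context: $\operatorname{crit}\phi$ is the set of critical points of a differentiable function $\phi$. A $C^2$ function $\phi:\mathbb{R}^m\to\mathbb{R}$ is Morse if $\nabla^2\phi(y)$ is invertible at every critical point $y$ of $\phi$; a $C^2$ function $g:\mathbb{R}^n\times\mathbb{R}^m\to\mathbb{R}$ is parametric Morse if $g_x$ is Morse for every $x\in\mathbb{R}^n$. Locally bounded means that every $\bar x\in\mathbb{R}^n$ has a neighborhood $U$ such that $\bigcup_{x\in U}\operatorname{crit}g_x$ is bounded. *)

(* Defs.v *)
From HB Require Import structures.
From mathcomp Require Import all_boot all_order all_algebra.
From mathcomp Require Import all_classical all_reals all_analysis.
(* Not imported: the notations of mpoly clash with those of mathcomp-analysis. *)
From mathcomp Require mpoly.

Set Implicit Arguments.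
Unset Strict Implicit.
Unset Printing Implicit Defensive.

Import Order.TTheory GRing.Theory Num.Theory.
Import numFieldNormedType.Exports.

Local Open Scope classical_set_scope.
Local Open Scope ring_scope.

(* The value of the polynomial p at the point x. *)
Definition peval (R : realType) p (f : mpoly.mpoly p R) (x : 'rV[R]_p) : R :=
  mpoly.meval (fun i => x 0 i) f.

(* A finite union of sets, each cut out by finitely many polynomial equations
   (first component) and strict inequalities (second component). *)
Definition semialgebraic_set (R : realType) p (A : set 'rV[R]_p) : Prop :=
  exists s : seq (seq (mpoly.mpoly p R) * seq (mpoly.mpoly p R)),
    A = [set x | has (fun c => all (fun f => peval f x == 0) c.1 &&
                               all (fun f => 0 < peval f x) c.2) s].

(* The graph of f is semi-algebraic in R^p * R^q, identified with R^(p+q). *)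
Definition semialgebraic_map (R : realType) p q (f : 'rV[R]_p -> 'rV[R]_q)
    : Prop :=
  semialgebraic_set [set row_mx x (f x) | x in [set: 'rV[R]_p]].

Definition semialgebraic_fun (R : realType) p (f : 'rV[R]_p -> R) : Prop :=
  semialgebraic_map (fun x => \row_(_ < 1) f x).

(* Class C^k on the whole space.  The spaces of interest are finite dimensional,
   so that continuity of the iterated derivatives in operator norm amounts to
   continuity of the iterated directional derivatives. *)
Fixpoint class_C (R : realType) (V W : normedModType R) (k : nat) (f : V -> W)
    : Prop :=
  if k is k'.+1 then
    (forall x, differentiable f x) /\ (forall v, class_C k' (fun x => 'D_v f x))
  else continuous f.

Definition partial (R : realType) m (i : 'I_m) (phi : 'rV[R]_m -> R)
    (y : 'rV[R]_m) : R :=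
  'D_(delta_mx 0 i) phi y.

Definition gradient (R : realType) m (phi : 'rV[R]_m -> R) (y : 'rV[R]_m)
    : 'rV[R]_m :=
  \row_i partial i phi y.

Definition hessian (R : realType) m (phi : 'rV[R]_m -> R) (y : 'rV[R]_m)
    : 'M[R]_m :=
  \matrix_(i, j) partial i (partial j phi) y.

Definition crit (R : realType) m (phi : 'rV[R]_m -> R) : set 'rV[R]_m :=
  [set y | gradient phi y = 0].

Definition local_minimizer (R : realType) m (phi : 'rV[R]_m -> R)
    (y : 'rV[R]_m) : Prop :=
  \forall z \near y, phi y <= phi z.

Definition Morse (R : realType) m (phi : 'rV[R]_m -> R) : Prop :=
  class_C 2 phi /\ forall y, crit phi y -> hessian phi y \in unitmx.

(* g_x, for g defined on R^n * R^m identified with R^(n+m). *)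
Definition slice (R : realType) n m (g : 'rV[R]_(n + m) -> R) (x : 'rV[R]_n)
    : 'rV[R]_m -> R :=
  fun y => g (row_mx x y).

Definition parametric_Morse (R : realType) n m (g : 'rV[R]_(n + m) -> R)
    : Prop :=
  class_C 2 g /\ forall x, Morse (slice g x).

Definition locally_bounded (R : realType) n m (F : 'rV[R]_n -> set 'rV[R]_m)
    : Prop :=
  forall x0 : 'rV[R]_n, exists2 U, nbhs x0 U & bounded_set (\bigcup_(x in U) F x).

Definition graph (R : realType) n m (f : 'rV[R]_n -> 'rV[R]_m)
    : set ('rV[R]_n * 'rV[R]_m) :=
  [set xy | xy.2 = f xy.1].

(* Main.v *)
(* By the implicit function theorem, the critical set is locally the graph of a
   C^(k-1) function of x, and by local boundedness its projection onto R^n is a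
   finite covering; since R^n is simply connected, it is the disjoint union of
   the graphs of finitely many continuous sections, which inherit the C^(k-1)
   regularity.  The Hessian is continuous, symmetric and invertible along a
   section, so that its positive definiteness, which characterises the local
   minimizers, holds everywhere or nowhere on a section.

   The critical set is semi-algebraic by quantifier elimination.  To see that a
   single section y is semi-algebraic, one orders the fibres by the linear
   functional l_c(v) = sum_j c^j v_j: as long as l_c separates the points of the
   fibres over a segment, the rank of y in its fibre is constant.  For fixed x, a
   c avoiding a countable set separates the fibres over all the rational points
   of the line R x; the parameters t where it does not separate the fibre over
   t x are then roots of nonzero polynomials taken from a description of this bad
   set which is uniform in (x, c), so that their number is bounded independently
   of x.  Hence the points of the graph of y are those which are connected to
   (0, y 0) by a chain of segments of bounded length, along each of which some
   l_c separates the fibres and the rank is preserved: a first-order condition. *)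

From HB Require Import structures.
Require Import Defs.
From mathcomp Require Import all_boot all_order all_algebra.
From mathcomp Require Import all_classical all_reals all_analysis.
From mathcomp Require Import lra ring.
From mathcomp Require Import -(notations) mpoly.
From mathcomp Require ordered_qelim qe_rcf.

Set Implicit Arguments.
Unset Strict Implicit.
Unset Printing Implicit Defensive.

Import Order.TTheory GRing.Theory Num.Theory.
Import numFieldNormedType.Exports.

Local Open Scope classical_set_scope.
Local Open Scope ring_scope.

(** * Semi-algebraic sets *)

(** No single l_c need separate all the fibres: if the difference of two sheets makes a half-turn
    around the origin of the plane, every l_c vanishes on it somewhere. So [c] has to change along
    the way, and a formula of fixed length requires a bound on the number of changes that is valid
    for all endpoints. The only tools for this are quantifier elimination and the finiteness of the
    roots of a polynomial; no cell decomposition is involved.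

    The covering argument uses no homotopy. Sections over two closed convex pieces that meet can be
    pasted, because the intersection is convex, hence connected; a box where this failed could be
    bisected down to a point.

    Strict differentiability, an estimate uniform in two moving points, serves three times: for the
    implicit function, for the symmetry of the Hessian, and for the second-order behaviour at a
    critical point. In the last case the mean value theorem replaces Taylor's formula, with an
    unknown positive factor [t] instead of 1/2: only signs matter. *)

Definition polynomial_fun (R : realType) p (f : 'rV[R]_p -> R) : Prop :=
  exists P, forall x, f x = peval P x.

Definition polynomial_map (R : realType) p q (f : 'rV[R]_p -> 'rV[R]_q) : Prop :=
  forall j, polynomial_fun (fun x => f x 0 j).

Section PolynomialFun.
Variables (R : realType) (p : nat).
Implicit Types f g : 'rV[R]_p -> R.

Lemma polynomial_fun_cst c : polynomial_fun (fun _ : 'rV[R]_p => c).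
Proof. by exists (mpoly.mpolyC p c) => x; rewrite /peval mpoly.mevalC. Qed.

Lemma polynomial_fun_coord (i : 'I_p) : polynomial_fun (fun x : 'rV[R]_p => x 0 i).
Proof. by exists (mpoly.mpolyX R (mpoly.mnm1 i)) => x; rewrite /peval mpoly.mevalXU. Qed.

Lemma polynomial_funD f g :
  polynomial_fun f -> polynomial_fun g -> polynomial_fun (fun x => f x + g x).
Proof. by move=> [P fP] [Q gQ]; exists (P + Q) => x; rewrite /peval mpoly.mevalD fP gQ. Qed.

Lemma polynomial_funN f : polynomial_fun f -> polynomial_fun (fun x => - f x).
Proof. by move=> [P fP]; exists (- P) => x; rewrite /peval mpoly.mevalN fP. Qed.

Lemma polynomial_funB f g :
  polynomial_fun f -> polynomial_fun g -> polynomial_fun (fun x => f x - g x).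
Proof. by move=> pf pg; apply: polynomial_funD => //; apply: polynomial_funN. Qed.

Lemma polynomial_funM f g :
  polynomial_fun f -> polynomial_fun g -> polynomial_fun (fun x => f x * g x).
Proof. by move=> [P fP] [Q gQ]; exists (P * Q) => x; rewrite /peval mpoly.mevalM fP gQ. Qed.

Lemma polynomial_funX f k : polynomial_fun f -> polynomial_fun (fun x => f x ^+ k).
Proof.
move=> pf; elim: k => [|k IHk]; first exact: polynomial_fun_cst.
by under eq_fun do rewrite exprS; apply: polynomial_funM.
Qed.

Lemma polynomial_fun_sum (I : Type) (s : seq I) (F : I -> 'rV[R]_p -> R) :
  (forall i, polynomial_fun (F i)) -> polynomial_fun (fun x => \sum_(i <- s) F i x).
Proof.
move=> pF; elim: s => [|i s IHs].
  by under eq_fun do rewrite big_nil; apply: polynomial_fun_cst.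
by under eq_fun do rewrite big_cons; apply: polynomial_funD.
Qed.

Lemma polynomial_fun_prod (I : Type) (s : seq I) (F : I -> 'rV[R]_p -> R) :
  (forall i, polynomial_fun (F i)) -> polynomial_fun (fun x => \prod_(i <- s) F i x).
Proof.
move=> pF; elim: s => [|i s IHs].
  by under eq_fun do rewrite big_nil; apply: polynomial_fun_cst.
by under eq_fun do rewrite big_cons; apply: polynomial_funM.
Qed.

Lemma polynomial_fun_comp q (h : 'rV[R]_q -> R) (phi : 'rV[R]_p -> 'rV[R]_q) :
  polynomial_fun h -> polynomial_map phi -> polynomial_fun (fun x => h (phi x)).
Proof.
move=> [P hP] pphi; under eq_fun do rewrite hP /peval mpoly.mevalE.
apply: polynomial_fun_sum => m; apply: polynomial_funM; first exact: polynomial_fun_cst.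
by apply: polynomial_fun_prod => i; apply: polynomial_funX; apply: pphi.
Qed.

End PolynomialFun.

Section PolynomialMap.
Variable (R : realType).

Lemma polynomial_map_id p : polynomial_map (fun x : 'rV[R]_p => x).
Proof. by move=> j; apply: polynomial_fun_coord. Qed.

Lemma polynomial_map_cst p q (c : 'rV[R]_q) : polynomial_map (fun _ : 'rV[R]_p => c).
Proof. by move=> j; apply: polynomial_fun_cst. Qed.

Lemma polynomial_map_comp p q r (h : 'rV[R]_q -> 'rV[R]_r) (phi : 'rV[R]_p -> 'rV[R]_q) :
  polynomial_map h -> polynomial_map phi -> polynomial_map (fun x => h (phi x)).
Proof. by move=> ph pphi j; apply: (polynomial_fun_comp (ph j)). Qed.

Lemma polynomial_map_lsub p q r (phi : 'rV[R]_p -> 'rV[R]_(q + r)) :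
  polynomial_map phi -> polynomial_map (fun x => lsubmx (phi x)).
Proof. by move=> pphi j; under eq_fun do rewrite mxE; apply: pphi. Qed.

Lemma polynomial_map_rsub p q r (phi : 'rV[R]_p -> 'rV[R]_(q + r)) :
  polynomial_map phi -> polynomial_map (fun x => rsubmx (phi x)).
Proof. by move=> pphi j; under eq_fun do rewrite mxE; apply: pphi. Qed.

Lemma polynomial_map_comp_lsub q r (phi : 'rV[R]_q -> 'rV[R]_r) s :
  polynomial_map phi -> polynomial_map (fun w : 'rV[R]_(q + s) => phi (lsubmx w)).
Proof.
move=> pphi; apply: polynomial_map_comp => //.
exact/polynomial_map_lsub/polynomial_map_id.
Qed.

Lemma polynomial_map_rsub_id q s : polynomial_map (fun w : 'rV[R]_(q + s) => rsubmx w).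
Proof. exact/polynomial_map_rsub/polynomial_map_id. Qed.

Lemma polynomial_map_row p q r (phi : 'rV[R]_p -> 'rV[R]_q) (psi : 'rV[R]_p -> 'rV[R]_r) :
  polynomial_map phi -> polynomial_map psi ->
  polynomial_map (fun x => row_mx (phi x) (psi x)).
Proof.
move=> pphi ppsi j; under eq_fun do rewrite mxE.
by case: (fintype.split j) => k; [apply: pphi | apply: ppsi].
Qed.

Lemma polynomial_mapD p q (phi psi : 'rV[R]_p -> 'rV[R]_q) :
  polynomial_map phi -> polynomial_map psi -> polynomial_map (fun x => phi x + psi x).
Proof. by move=> pphi ppsi j; under eq_fun do rewrite mxE; apply: polynomial_funD. Qed.

Lemma polynomial_mapB p q (phi psi : 'rV[R]_p -> 'rV[R]_q) :
  polynomial_map phi -> polynomial_map psi -> polynomial_map (fun x => phi x - psi x).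
Proof. by move=> pphi ppsi j; under eq_fun do rewrite !mxE; apply: polynomial_funB. Qed.

Lemma polynomial_mapZ p q (a : 'rV[R]_p -> R) (phi : 'rV[R]_p -> 'rV[R]_q) :
  polynomial_fun a -> polynomial_map phi -> polynomial_map (fun x => a x *: phi x).
Proof. by move=> pa pphi j; under eq_fun do rewrite mxE; apply: polynomial_funM. Qed.

End PolynomialMap.

Section Semialgebraic.
Variable (R : realType).

Definition sa_clause p (c : seq (mpoly.mpoly p R) * seq (mpoly.mpoly p R))
    (x : 'rV[R]_p) : bool :=
  all (fun f => peval f x == 0) c.1 && all (fun f => 0 < peval f x) c.2.

Lemma semialgebraicP p (A : set 'rV[R]_p) :
  semialgebraic_set A <->
  exists s : seq (seq (mpoly.mpoly p R) * seq (mpoly.mpoly p R)),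
    forall x, A x <-> has (fun c => sa_clause c x) s.
Proof.
split=> [[s ->]|[s As]]; first by exists s.
by exists s; apply/seteqP; split=> x /As.
Qed.

Lemma sa_ext p (A B : set 'rV[R]_p) :
  (forall x, A x <-> B x) -> semialgebraic_set A -> semialgebraic_set B.
Proof.
by move=> AB; rewrite (_ : A = B) //; apply/seteqP; split=> x /AB.
Qed.

Lemma sa_eq0 p (f : 'rV[R]_p -> R) : polynomial_fun f -> semialgebraic_set (fun x => f x = 0).
Proof.
move=> [P fP]; apply/semialgebraicP; exists [:: ([:: P], [::])] => x.
by rewrite /sa_clause /= -fP !andbT orbF; split=> /eqP.
Qed.

Lemma sa_gt0 p (f : 'rV[R]_p -> R) : polynomial_fun f -> semialgebraic_set (fun x => 0 < f x).
Proof.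
move=> [P fP]; apply/semialgebraicP; exists [:: ([::], [:: P])] => x.
by rewrite /sa_clause /= -fP !andbT orbF.
Qed.

Lemma sa_or p (A B : set 'rV[R]_p) : semialgebraic_set A -> semialgebraic_set B ->
  semialgebraic_set (fun x => A x \/ B x).
Proof.
move=> /semialgebraicP[s As] /semialgebraicP[t Bt]; apply/semialgebraicP.
by exists (s ++ t) => x; rewrite has_cat As Bt; split=> [/orP|/orP].
Qed.

Lemma sa_and p (A B : set 'rV[R]_p) : semialgebraic_set A -> semialgebraic_set B ->
  semialgebraic_set (fun x => A x /\ B x).
Proof.
move=> /semialgebraicP[s As] /semialgebraicP[t Bt]; apply/semialgebraicP.
exists [seq (c.1 ++ d.1, c.2 ++ d.2) | c <- s, d <- t] => x; rewrite As Bt.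
have E c d : sa_clause (c.1 ++ d.1, c.2 ++ d.2) x = sa_clause c x && sa_clause d x.
  by rewrite /sa_clause /= !all_cat andbACA.
split=> [[/hasP[c cs cx] /hasP[d dt dx]]|/hasP[cd /allpairsP[[c d] /= [cs dt ->]]]].
  apply/hasP; exists (c.1 ++ d.1, c.2 ++ d.2); last by rewrite E cx.
  by apply/allpairsP; exists (c, d).
by rewrite E => /andP[cx dx]; split; apply/hasP; [exists c | exists d].
Qed.

Lemma sa_cst p (P : Prop) : semialgebraic_set (fun _ : 'rV[R]_p => P).
Proof.
have [p1|p0] := pselect P.
  by apply: (@sa_ext _ (fun _ => 0 = 0 :> R)) => //; apply/sa_eq0/polynomial_fun_cst.
apply: (@sa_ext _ (fun _ => 1 = 0 :> R)); last by apply/sa_eq0/polynomial_fun_cst.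
by move=> _; split=> // /eqP; rewrite oner_eq0.
Qed.

Lemma sa_bigand p (I : finType) (A : I -> set 'rV[R]_p) :
  (forall i, semialgebraic_set (A i)) -> semialgebraic_set (fun x => forall i, A i x).
Proof.
move=> sA; suff H (s : seq I) : semialgebraic_set (fun x => forall i, i \in s -> A i x).
  by apply: sa_ext (H (index_enum I)) => x; split=> h i // ; apply: h; apply: mem_index_enum.
elim: s => [|i s IHs]; first exact: (@sa_ext _ (fun _ => True)) (sa_cst _ _).
apply: sa_ext (sa_and (sA i) IHs) => x; split=> [[Ai As] j|As].
  by rewrite inE => /orP[/eqP->|/As].
by split=> [|j js]; apply: As; rewrite inE ?eqxx // js orbT.
Qed.

Lemma sa_bigor p (I : eqType) (s : seq I) (A : I -> set 'rV[R]_p) :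
  (forall i, semialgebraic_set (A i)) ->
  semialgebraic_set (fun x => exists2 i, i \in s & A i x).
Proof.
move=> sA; elim: s => [|i s IHs].
  by apply: (@sa_ext _ (fun _ => False)) (sa_cst _ _) => x; split=> // -[].
apply: sa_ext (sa_or (sA i) IHs) => x; split=> [[Ai|[j js Aj]]|[j]].
- by exists i; rewrite ?inE ?eqxx.
- by exists j; rewrite ?inE ?js ?orbT.
- by rewrite inE => /orP[/eqP->|js Aj]; [left | right; exists j].
Qed.

(** De Morgan on the normal form. A negated atom is again a disjunction of atoms: f <> 0 means 0 < f
    or 0 < - f, and the negation of 0 < f means f = 0 or 0 < - f. *)
Lemma sa_not p (A : set 'rV[R]_p) : semialgebraic_set A ->
  semialgebraic_set (fun x => ~ A x).
Proof.
have polyP (f : mpoly.mpoly p R) : polynomial_fun (fun x => peval f x) by exists f.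
have neq (f : mpoly.mpoly p R) : semialgebraic_set (fun x => ~ (peval f x == 0)).
  apply: (@sa_ext _ (fun x => 0 < peval f x \/ 0 < - peval f x)).
    move=> x; rewrite oppr_gt0; split=> [|/negP]; last by rewrite neq_lt => /orP[]; tauto.
    by case=> fx; apply/negP; rewrite neq_lt fx ?orbT.
  by apply: sa_or; apply: sa_gt0 => //; apply: polynomial_funN.
have ngt (f : mpoly.mpoly p R) : semialgebraic_set (fun x => ~ (0 < peval f x)).
  apply: (@sa_ext _ (fun x => peval f x = 0 \/ 0 < - peval f x)).
    move=> x; rewrite oppr_gt0; split=> [[->|fx]|/negP]; first by rewrite ltxx.
      by apply/negP; rewrite -leNgt ltW.
    by rewrite -leNgt le_eqVlt => /orP[/eqP|]; tauto.
  by apply: sa_or; [apply: sa_eq0 | apply: sa_gt0 => //; apply: polynomial_funN].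
have clause c : semialgebraic_set (fun x => ~ @sa_clause p c x).
  apply: sa_ext (sa_or (sa_bigor c.1 neq) (sa_bigor c.2 ngt)) => x; split.
    by case=> -[f fc nf] /andP[/allP c1 /allP c2]; apply: nf; [apply: c1 | apply: c2].
  move/negP; rewrite negb_and => /orP[] /allPn[f fc /negP fx]; [left|right]; by exists f.
move=> /semialgebraicP[s As].
apply: (@sa_ext _ (fun x => ~ has (fun c => @sa_clause p c x) s)) => [x|{As}]; first by rewrite As.
elim: s => [|c s IHs]; first by apply: (@sa_ext _ (fun _ => True)) (sa_cst _ _).
apply: sa_ext (sa_and (clause c) IHs) => x /=.
by split=> [[nc ns] /orP[]|/negP] //; rewrite negb_or => /andP[/negP ? /negP].
Qed.

Lemma sa_imply p (A B : set 'rV[R]_p) : semialgebraic_set A -> semialgebraic_set B ->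
  semialgebraic_set (fun x => A x -> B x).
Proof.
move=> sA sB; apply: sa_ext (sa_or (sa_not sA) sB) => x; split; first tauto.
by move=> AB; have [/AB|] := pselect (A x); tauto.
Qed.

Lemma sa_iff p (A B : set 'rV[R]_p) : semialgebraic_set A -> semialgebraic_set B ->
  semialgebraic_set (fun x => A x <-> B x).
Proof. by move=> sA sB; apply: sa_and; apply: sa_imply. Qed.

Lemma sa_preimage p q (A : set 'rV[R]_q) (phi : 'rV[R]_p -> 'rV[R]_q) :
  semialgebraic_set A -> polynomial_map phi -> semialgebraic_set (fun x => A (phi x)).
Proof.
move=> /semialgebraicP[s As] pphi.
have pp (f : mpoly.mpoly q R) : polynomial_fun (fun x => peval f (phi x)).
  by apply: (polynomial_fun_comp _ pphi); exists f.
apply: (@sa_ext _ (fun x => has (fun c => @sa_clause q c (phi x)) s)) => [x|{As}].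
  by rewrite As.
elim: s => [|c s IHs]; first by apply: (@sa_ext _ (fun _ => False)) (sa_cst _ _).
suff C : semialgebraic_set (fun x => sa_clause c (phi x)).
  by apply: sa_ext (sa_or C IHs) => x /=; split=> /orP.
rewrite /sa_clause; case: c => c d /=.
have Cc : semialgebraic_set (fun x => all (fun f => peval f (phi x) == 0) c).
  elim: c => [|f c IHc]; first by apply: (@sa_ext _ (fun _ => True)) (sa_cst _ _).
  apply: sa_ext (sa_and (sa_eq0 (pp f)) IHc) => x /=.
  by split=> [[-> ->]|/andP[/eqP]]; rewrite ?eqxx.
have Cd : semialgebraic_set (fun x => all (fun f => 0 < peval f (phi x)) d).
  elim: d => [|f d IHd]; first by apply: (@sa_ext _ (fun _ => True)) (sa_cst _ _).
  by apply: sa_ext (sa_and (sa_gt0 (pp f)) IHd) => x /=; split=> [[-> ->]|/andP[]].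
by apply: sa_ext (sa_and Cc Cd) => x; split=> [[-> ->]|/andP[]].
Qed.

Lemma sa_eq p (f g : 'rV[R]_p -> R) : polynomial_fun f -> polynomial_fun g ->
  semialgebraic_set (fun x => f x = g x).
Proof.
move=> pf pg; apply: sa_ext (sa_eq0 (polynomial_funB pf pg)) => x.
by split=> [/eqP|->]; rewrite ?subrr // subr_eq0 => /eqP.
Qed.

Lemma sa_lt p (f g : 'rV[R]_p -> R) : polynomial_fun f -> polynomial_fun g ->
  semialgebraic_set (fun x => f x < g x).
Proof.
by move=> pf pg; apply: sa_ext (sa_gt0 (polynomial_funB pg pf)) => x; rewrite subr_gt0.
Qed.

Lemma sa_le p (f g : 'rV[R]_p -> R) : polynomial_fun f -> polynomial_fun g ->
  semialgebraic_set (fun x => f x <= g x).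
Proof.
move=> pf pg; apply: sa_ext (sa_not (sa_lt pg pf)) => x.
by rewrite leNgt; split=> /negP.
Qed.

Lemma sa_eqmx p q (f g : 'rV[R]_p -> 'rV[R]_q) : polynomial_map f -> polynomial_map g ->
  semialgebraic_set (fun x => f x = g x).
Proof.
move=> pf pg; apply: (@sa_ext _ (fun x => forall j, f x 0 j = g x 0 j)).
  by move=> x; split=> [h|-> //]; apply/rowP.
by apply: sa_bigand => j; apply: sa_eq.
Qed.

End Semialgebraic.

(** * Quantifier elimination *)

Section QuantifierElimination.
Variable (R : realType).
Import ordered_qelim.ord.
Local Close Scope oclause_scope.

Definition rv_seq p (x : 'rV[R]_p) : seq R := [seq x 0 i | i <- enum 'I_p].

Lemma size_rv_seq p (x : 'rV[R]_p) : size (rv_seq x) = p.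
Proof. by rewrite size_map size_enum_ord. Qed.

Lemma nth_rv_seq p (x : 'rV[R]_p) (i : 'I_p) : (rv_seq x)`_i = x 0 i.
Proof. by rewrite (nth_map i) ?size_enum_ord // nth_ord_enum. Qed.

Definition monomial_term p (m : multinom p) : GRing.term R :=
  foldr (fun (i : 'I_p) u => GRing.Mul (GRing.Exp (GRing.Var R i) (m i)) u)
    (GRing.NatConst R 1) (enum 'I_p).

Definition mpoly_term p (P : mpoly p R) : GRing.term R :=
  foldr (fun m t => GRing.Add (GRing.Mul (GRing.Const (mcoeff m P)) (monomial_term m)) t)
    (GRing.NatConst R 0) (msupp P).

Lemma rterm_mpoly_term p (P : mpoly p R) : GRing.rterm (mpoly_term P).
Proof.
rewrite /mpoly_term; elim: (msupp P) => //= m s ->; rewrite andbT.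
by rewrite /monomial_term; elim: (enum 'I_p).
Qed.

Lemma eval_mpoly_term p (P : mpoly p R) e (x : 'rV[R]_p) :
  (forall i : 'I_p, e`_i = x 0 i) -> GRing.eval e (mpoly_term P) = peval P x.
Proof.
move=> ex; rewrite /mpoly_term /peval mevalE.
elim: (msupp P) => [|m s IHs] /=; first by rewrite big_nil.
rewrite big_cons IHs; congr (_ * _ + _); rewrite /monomial_term.
rewrite -big_enum /=; elim: (enum 'I_p) => [|i t IHt] /=; first by rewrite big_nil.
by rewrite big_cons IHt ex.
Qed.

(** The valuation [e] is only constrained on its first [p] entries: the semantics of [Exists]
    produces valuations by [set_nth], which are not of the form [rv_seq x]. *)
Lemma semialgebraic_formula p (A : set 'rV[R]_p) : semialgebraic_set A ->
  exists2 f, rformula f & forall e (x : 'rV[R]_p),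
    (forall i : 'I_p, e`_i = x 0 i) -> (holds e f <-> A x).
Proof.
move=> /semialgebraicP[s As].
pose fall (l : seq (mpoly p R)) (a : mpoly p R -> formula R) :=
  foldr (fun P f => And (a P) f) (Bool true) l.
pose eqf (P : mpoly p R) := Equal (mpoly_term P) (GRing.NatConst R 0).
pose ltf (P : mpoly p R) := Lt (GRing.NatConst R 0) (mpoly_term P).
exists (foldr (fun c f => Or (And (fall c.1 eqf) (fall c.2 ltf)) f) (Bool false) s).
  elim: s {As} => //= -[c d] s ->; rewrite andbT; apply/andP; split=> /=.
    by elim: c => //= P c ->; rewrite rterm_mpoly_term.
  by elim: d => //= P d ->; rewrite rterm_mpoly_term.
move=> e x ex; rewrite As {A As}; elim: s => //= -[c d] s [IH1 IH2].
have Ec : holds e (fall c eqf) <-> all (fun f => peval f x == 0) c.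
  elim: c => //= P c [IHc1 IHc2]; rewrite (eval_mpoly_term _ ex).
  by split=> [[-> /IHc1->]|/andP[/eqP-> /IHc2]]; rewrite ?eqxx.
have Ed : holds e (fall d ltf) <-> all (fun f => 0 < peval f x) d.
  elim: d => //= P d [IHd1 IHd2]; rewrite (eval_mpoly_term _ ex).
  by split=> [[-> /IHd1->]|/andP[-> /IHd2]].
split=> [[[/Ec c1 /Ed d1]|/IH1->]|/orP[/andP[/Ec ? /Ed ?]|/IH2]]; rewrite ?orbT //.
- by rewrite /sa_clause /= c1 d1.
- by left.
- by right.
Qed.

Lemma polynomial_fun_eval p (t : GRing.term R) : GRing.rterm t ->
  polynomial_fun (fun x : 'rV[R]_p => GRing.eval (rv_seq x) t).
Proof.
elim: t => //=.
- move=> i _; have [ip|pi] := ltnP i p.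
    have := polynomial_fun_coord R (Ordinal ip); congr polynomial_fun.
    by apply/funext => x; rewrite -nth_rv_seq.
  (* A variable of index at least [p] is read beyond the end of [rv_seq x], where [nth] returns its
     default 0. *)
  have := @polynomial_fun_cst R p 0; congr polynomial_fun.
  by apply/funext => x; rewrite nth_default // size_rv_seq.
- by move=> r _; apply: polynomial_fun_cst.
- by move=> n _; apply: polynomial_fun_cst.
- by move=> t IHt u IHu /andP[/IHt pt /IHu pu]; apply: polynomial_funD.
- by move=> t IHt /IHt; apply: polynomial_funN.
- move=> t IHt n /IHt pt; under eq_fun do rewrite -mulr_natl.
  by apply: polynomial_funM => //; apply: polynomial_fun_cst.
- by move=> t IHt u IHu /andP[/IHt pt /IHu pu]; apply: polynomial_funM.
- by move=> t IHt n /IHt pt; apply: polynomial_funX.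
Qed.

Lemma semialgebraic_qf_eval p (f : formula R) : qf_form f -> rformula f ->
  semialgebraic_set (fun x : 'rV[R]_p => qf_eval (rv_seq x) f).
Proof.
elim: f => //=.
- by move=> b _ _; apply: sa_cst.
- move=> t u _ /andP[rt ru].
  apply: sa_ext (sa_eq (polynomial_fun_eval p rt) (polynomial_fun_eval p ru)) => x.
  by split=> /eqP.
- move=> t u _ /andP[rt ru].
  exact: sa_lt (polynomial_fun_eval p rt) (polynomial_fun_eval p ru).
- move=> t u _ /andP[rt ru].
  exact: sa_le (polynomial_fun_eval p rt) (polynomial_fun_eval p ru).
- move=> f IHf g IHg /andP[qf qg] /andP[rf rg].
  by apply: sa_ext (sa_and (IHf qf rf) (IHg qg rg)) => x; split=> /andP.
- move=> f IHf g IHg /andP[qf qg] /andP[rf rg].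
  by apply: sa_ext (sa_or (IHf qf rf) (IHg qg rg)) => x; split=> /orP.
- move=> f IHf g IHg /andP[qf qg] /andP[rf rg].
  by apply: sa_ext (sa_imply (IHf qf rf) (IHg qg rg)) => x; split=> /implyP.
- move=> f IHf qf rf.
  by apply: sa_ext (sa_not (IHf qf rf)) => x; split=> /negP.
Qed.

(** Tarski's theorem enters here. The coordinates of [x] are the variables 0, ..., p - 1, so the
    last coordinate of [w] is the variable that [Exists p] binds. *)
Lemma semialgebraic_exists1 p (P : 'rV[R]_p -> 'rV[R]_1 -> Prop) :
  semialgebraic_set (fun w : 'rV_(p + 1) => P (lsubmx w) (rsubmx w)) ->
  semialgebraic_set (fun x => exists v, P x v).
Proof.
move=> /semialgebraic_formula[f rf fP].
pose wf := @qe_rcf.wf_QE_wproj R; pose valid := @qe_rcf.valid_QE_wproj R.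
have rg : rformula (Exists p f) by [].
have /andP[qqg rqg] := quantifier_elim_wf wf rg.
apply: sa_ext (semialgebraic_qf_eval p qqg rqg) => x.
rewrite -(rwP (quantifier_elim_rformP wf valid (rv_seq x) rg)) /=.
have E v (i : 'I_(p + 1)) : (set_nth 0 (rv_seq x) p v)`_i = row_mx x (v%:M) 0 i.
  rewrite nth_set_nth /= mxE; case: splitP => j ->.
    by rewrite (ltn_eqF (ltn_ord j)) nth_rv_seq.
  by rewrite ord1 addn0 eqxx mxE mulr1n.
split=> [[v /(fP _ _ (E v))]|[v Pxv]].
  by rewrite row_mxKl row_mxKr => ?; exists v%:M.
exists (v 0 0); apply/(fP _ _ (E _)); rewrite row_mxKl row_mxKr.
by rewrite -mx11_scalar.
Qed.

Lemma sa_exists p q (P : 'rV[R]_p -> 'rV[R]_q -> Prop) :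
  semialgebraic_set (fun w : 'rV_(p + q) => P (lsubmx w) (rsubmx w)) ->
  semialgebraic_set (fun x => exists v, P x v).
Proof.
elim: q p P => [|q IHq] p P sP.
  have pr : polynomial_map (fun x : 'rV[R]_p => row_mx x (0 : 'rV[R]_0)).
    by apply: polynomial_map_row; [apply: polynomial_map_id | apply: polynomial_map_cst].
  apply: sa_ext (sa_preimage sP pr) => x; rewrite row_mxKl row_mxKr.
  by split=> [|[v]]; [exists 0 | rewrite (thinmx0 v)].
apply: (@sa_ext _ _ (fun x => exists v : 'rV_1, exists z : 'rV_q, P x (row_mx v z))).
  move=> x; split=> [[v [z Pz]]|[v]]; first by exists (row_mx v z).
  rewrite -[v in P x v](@hsubmxK _ 1 1 q) => Pv.
  by exists (@lsubmx _ 1 1 q v), (@rsubmx _ 1 1 q v).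
apply: semialgebraic_exists1; apply: IHq.
(* The dimensions (p + 1) + q and p + (1 + q) give distinct types, between which [phi]
   re-brackets. *)
pose phi (w : 'rV[R]_((p + 1) + q)) : 'rV[R]_(p + (1 + q)) :=
  row_mx (lsubmx (lsubmx w)) (row_mx (rsubmx (lsubmx w)) (rsubmx w)).
have pphi : polynomial_map phi.
  have pid := @polynomial_map_id R ((p + 1) + q).
  apply: polynomial_map_row; first by do 2! apply: polynomial_map_lsub.
  apply: polynomial_map_row; last exact: polynomial_map_rsub.
  by apply: polynomial_map_rsub; apply: polynomial_map_lsub.
by apply: sa_ext (sa_preimage sP pphi) => w; rewrite row_mxKl row_mxKr.
Qed.

Lemma sa_forall p q (P : 'rV[R]_p -> 'rV[R]_q -> Prop) :
  semialgebraic_set (fun w : 'rV_(p + q) => P (lsubmx w) (rsubmx w)) ->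
  semialgebraic_set (fun x => forall v, P x v).
Proof.
move=> sP; have sN : semialgebraic_set (fun x => exists v, ~ P x v).
  by apply: sa_exists; apply: sa_not.
apply: sa_ext (sa_not sN) => x; split=> [h v|h [v]]; last by apply.
by apply: contrapT => nP; apply: h; exists v.
Qed.

End QuantifierElimination.

(** * Uniform finiteness *)

Section UniformFiniteness.
Variable R : realType.

(** Roots are split off one at a time, each lowering the size by one. *)
Lemma root_list (q : {poly R}) : q != 0 ->
  exists2 s : seq R, (size s <= size q)%N & forall t, root q t -> t \in s.
Proof.
have [k le_qk] := ubnP (size q); elim: k => // k IHk in q le_qk * => q0.
have [[a /factor_theorem[u qu]]|noroot] := pselect (exists a, root q a); last first.
  by exists [::] => // t qt; case: noroot; exists t.
have u0 : u != 0 by apply: contraNneq q0 => u0; rewrite qu u0 mul0r.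
have sq : size q = (size u).+1.
  by rewrite qu size_Mmonic ?monicXsubC // size_XsubC addn2.
have [|s su us] := IHk u _ u0; first by rewrite -ltnS -sq.
exists (a :: s) => [|t]; first by rewrite sq ltnS.
by rewrite qu rootM root_XsubC inE => /orP[/us->|->]; rewrite ?orbT.
Qed.

Definition slice_poly p (P : mpoly (p + 1) R) (x : 'rV[R]_p) : {poly R} :=
  \sum_(m <- msupp P)
    (mcoeff m P * \prod_(i < p) x 0 i ^+ m (lshift 1 i)) *: 'X^(m (rshift p 0)).

(** The bound does not depend on [x]; all uniformity in [x] originates here. *)
Lemma size_slice_poly p (P : mpoly (p + 1) R) x : (size (slice_poly P x) <= msize P)%N.
Proof.
rewrite /slice_poly big_seq; apply: (big_ind (fun q : {poly R} => size q <= msize P)%N).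
- by rewrite size_poly0.
- by move=> q r sq sr; rewrite (leq_trans (size_polyD _ _)) // geq_max sq.
- move=> m mP; rewrite (leq_trans (size_scale_leq _ _)) // size_polyXn.
  rewrite (leq_trans _ (msize_mdeg_lt mP)) // ltnS mdegE.
  by rewrite (bigD1 (rshift p 0)) //= leq_addr.
Qed.

Lemma horner_slice_poly p (P : mpoly (p + 1) R) x t :
  (slice_poly P x).[t] = peval P (row_mx x t%:M).
Proof.
rewrite /peval mevalE horner_sum; apply: eq_bigr => m _.
rewrite hornerZ hornerXn -mulrA big_split_ord /= big_ord1; congr (_ * (_ * _)).
  by apply: eq_bigr => i _; rewrite row_mxEl.
by rewrite row_mxEr mxE mulr1n.
Qed.

(* A point of [A x] at which all the polynomial equations of some clause vanish
   identically in [t] would be interior to [A x]. *)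
Lemma semialgebraic_uniform_finiteness p (A : 'rV[R]_p -> R -> Prop) :
  semialgebraic_set (fun w : 'rV_(p + 1) => A (lsubmx w) (rsubmx w 0 0)) ->
  exists K, forall x, (forall a b, a < b -> exists t, a < t < b /\ ~ A x t) ->
    exists2 s : seq R, (size s <= K)%N & forall t, A x t -> t \in s.
Proof.
move=> /semialgebraicP[s As].
(* Which slices vanish identically depends on [x], so the bound counts the possible roots of every
   equation of every clause. *)
exists (\sum_(c <- s) \sum_(P <- c.1) msize P)%N => x dense_nA.
have {As} As t : A x t <-> has (fun c => sa_clause c (row_mx x t%:M)) s.
  by rewrite -As row_mxKl row_mxKr mxE mulr1n.
have Aroot t : A x t -> exists2 c, c \in s &
    exists2 P, P \in c.1 & slice_poly P x != 0 /\ root (slice_poly P x) t.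
  move=> /As/hasP[c cs /andP[/allP c1 /allP c2]]; exists c => //.
  apply: contrapT => nP.
  have z P : P \in c.1 -> slice_poly P x = 0.
    move=> Pc; apply: contrapT => /eqP P0; apply: nP; exists P => //; split=> //.
    by rewrite /root horner_slice_poly c1.
  have : \forall u \near t, A x u.
    have : \forall u \near t, all (fun P => 0 < peval P (row_mx x u%:M)) c.2.
      elim: c.2 c2 => [|P l IHl] c2 /=; first by near=> u.
      have IH : \forall u \near t, all (fun P => 0 < peval P (row_mx x u%:M)) l.
        by apply: IHl => Q Ql; apply: c2; rewrite inE Ql orbT.
      have Pt : \forall u \near t, 0 < (slice_poly P x).[u].
        have /cvgr_gt := @continuous_horner R (slice_poly P x) t; apply.
        by rewrite horner_slice_poly c2 // inE eqxx.
      by near=> u; rewrite -horner_slice_poly; apply/andP; split; near: u.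
    apply: filterS => u c2u; apply/As/hasP; exists c => //; rewrite /sa_clause c2u andbT.
    by apply/allP => P Pc; rewrite -horner_slice_poly z // horner0.
  move=> /nbhs_ballP[e /= e0 te].
  have [|u [/andP[tu ue] []]] := dense_nA t (t + e); first by rewrite ltrDl.
  by apply: te; rewrite /ball /= ltr_norml; apply/andP; split; lra.
suff H (l : seq (seq (mpoly (p + 1) R) * seq (mpoly (p + 1) R))) :
  exists2 r : seq R, (size r <= \sum_(c <- l) \sum_(P <- c.1) msize P)%N &
    forall c, c \in l -> forall P, P \in c.1 -> slice_poly P x != 0 ->
      forall t, root (slice_poly P x) t -> t \in r.
  have [r sr rP] := H s; exists r => // t /Aroot[c cs [P Pc [P0 Pt]]].
  exact: rP cs _ Pc P0 _ Pt.
elim: l => [|c l [r sr rP]]; first by exists [::].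
suff [r' sr' r'P] : exists2 r' : seq R, (size r' <= \sum_(P <- c.1) msize P)%N &
    forall P, P \in c.1 -> slice_poly P x != 0 ->
      forall t, root (slice_poly P x) t -> t \in r'.
  exists (r' ++ r) => [|d]; first by rewrite size_cat big_cons leq_add.
  rewrite inE => /orP[/eqP->|dl] P Pd P0 t Pt; rewrite mem_cat.
    by rewrite (r'P P).
  by rewrite (rP d dl P) // orbT.
elim: c.1 => [|P l' [r' sr' r'P]]; first by exists [::].
have [P0|P0] := eqVneq (slice_poly P x) 0.
  exists r' => [|Q]; first by rewrite big_cons (leq_trans sr') // leq_addl.
  by rewrite inE => /orP[/eqP->|/r'P//]; rewrite P0 eqxx.
have [u su uP] := root_list P0; exists (u ++ r') => [|Q].
  by rewrite size_cat big_cons leq_add // (leq_trans su) ?size_slice_poly.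
rewrite inE => /orP[/eqP->|Ql] Q0 t Qt; rewrite mem_cat; first by rewrite uP.
by rewrite (r'P Q) ?orbT.
Unshelve. all: by end_near. Qed.

End UniformFiniteness.

(** * Continuous sections are semi-algebraic *)

Lemma continuous_sum (R : realType) (T : topologicalType) (V : normedModType R)
    (I : Type) (s : seq I) (F : I -> T -> V) :
  (forall i, continuous (F i)) -> continuous (fun x => \sum_(i <- s) F i x).
Proof.
move=> cF; elim: s => [|i s IHs] x.
  by under eq_fun do rewrite big_nil; exact: cvg_cst.
under eq_fun do rewrite big_cons.
by apply: cvgD; [exact: cF | exact: IHs].
Qed.

Lemma line_continuous (R : realType) (V : normedModType R) (x d : V) :
  continuous (fun t : R => x + t *: d).
Proof. by move=> t; apply: cvgD; [exact: cvg_cst | apply: cvgZr_tmp; exact: cvg_id]. Qed.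

Section Sheets.
Variables (R : realType) (n m M : nat).
Variables (Z : 'rV[R]_n -> 'rV[R]_m -> Prop) (y : 'I_M -> 'rV[R]_n -> 'rV[R]_m).
Hypothesis Z_semialgebraic :
  semialgebraic_set (fun w : 'rV_(n + m) => Z (lsubmx w) (rsubmx w)).
Hypothesis y_continuous : forall i, continuous (y i).
Hypothesis y_distinct : forall x i j, i <> j -> y i x <> y j x.
Hypothesis y_graphs : forall x v, Z x v <-> exists i, v = y i x.

Let Zy x i : Z x (y i x).
Proof. by apply/y_graphs; exists i. Qed.

Let y_inj x i j : y i x = y j x -> i = j.
Proof. by move=> yij; apply: contrapT => /(@y_distinct x). Qed.

(** Weights along the moment curve: for distinct [v] and [v'], the equation
    [moment c v = moment c v'] is a nonzero polynomial equation in the single unknown [c]. *)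
Definition moment (c : R) (v : 'rV[R]_m) : R := \sum_(j < m) c ^+ j * v 0 j.

Definition separates (c : R) (x : 'rV[R]_n) : Prop :=
  forall v v', Z x v -> Z x v' -> moment c v = moment c v' -> v = v'.

(* At least [r] points of the fibre [Z x] have a smaller [moment c] than [v]:
   this expresses the rank of [v] in its fibre by a first-order formula. *)
Fixpoint prec (r : nat) (c : R) (x : 'rV[R]_n) (v : 'rV[R]_m) : Prop :=
  if r is r'.+1 then
    Z x v /\ exists v', prec r' c x v' /\ moment c v' < moment c v
  else Z x v.

(* If [c] separates the fibres over the whole segment [x, x'], the order of the
   sheets by [moment c] is constant there, so that a point of [Z x] and a point
   of [Z x'] lie on the same sheet as soon as they have the same rank.  Scalars
   are quantified as ['rV_1] in order to apply [sa_exists] and [sa_forall]. *)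
Definition link (x : 'rV[R]_n) (v : 'rV[R]_m) (x' : 'rV[R]_n) (v' : 'rV[R]_m) : Prop :=
  (Z x v /\ Z x' v') /\
  exists c : 'rV[R]_1,
    (forall t : 'rV[R]_1, 0 <= t 0 0 /\ t 0 0 <= 1 ->
       separates (c 0 0) (x + t 0 0 *: (x' - x))) /\
    (forall r : 'I_M.+1, prec r (c 0 0) x v <-> prec r (c 0 0) x' v').

Fixpoint chain (k : nat) (x : 'rV[R]_n) (v : 'rV[R]_m)
    (x' : 'rV[R]_n) (v' : 'rV[R]_m) : Prop :=
  if k is k'.+1 then
    exists x'', exists v'', link x v x'' v'' /\ chain k' x'' v'' x' v'
  else x = x' /\ v = v'.

(** Here and in the lemmas below, the arguments are polynomial maps of a common parameter [w], so
    that the results still apply after each quantifier has added coordinates to [w]. *)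
Lemma sa_Z q (x : 'rV[R]_q -> 'rV[R]_n) (v : 'rV[R]_q -> 'rV[R]_m) :
  polynomial_map x -> polynomial_map v -> semialgebraic_set (fun w => Z (x w) (v w)).
Proof.
move=> px pv; apply: sa_ext (sa_preimage Z_semialgebraic (polynomial_map_row px pv)) => w.
by rewrite row_mxKl row_mxKr.
Qed.

Lemma polynomial_moment q (c : 'rV[R]_q -> 'rV[R]_1) (v : 'rV[R]_q -> 'rV[R]_m) :
  polynomial_map c -> polynomial_map v ->
  polynomial_fun (fun w => moment (c w 0 0) (v w)).
Proof.
move=> pc pv; apply: polynomial_fun_sum => j; apply: polynomial_funM (pv j).
exact: polynomial_funX.
Qed.

Lemma sa_separates q (c : 'rV[R]_q -> 'rV[R]_1) (x : 'rV[R]_q -> 'rV[R]_n) :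
  polynomial_map c -> polynomial_map x ->
  semialgebraic_set (fun w => separates (c w 0 0) (x w)).
Proof.
move=> pc px; apply: (sa_forall (P := fun w v => forall v', Z (x w) v -> Z (x w) v' ->
  moment (c w 0 0) v = moment (c w 0 0) v' -> v = v')).
apply: (sa_forall (P := fun w v' => Z (x (lsubmx w)) (rsubmx w) -> Z (x (lsubmx w)) v' ->
  moment (c (lsubmx w) 0 0) (rsubmx w) = moment (c (lsubmx w) 0 0) v' -> rsubmx w = v')).
have px' := polynomial_map_comp_lsub m (polynomial_map_comp_lsub m px).
have pc' := polynomial_map_comp_lsub m (polynomial_map_comp_lsub m pc).
have pv := polynomial_map_comp_lsub m (@polynomial_map_rsub_id R q m).
have pv' := @polynomial_map_rsub_id R (q + m) m.
apply: sa_imply; first exact: sa_Z.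
apply: sa_imply; first exact: sa_Z.
by apply: sa_imply; [apply: sa_eq; apply: polynomial_moment | apply: sa_eqmx].
Qed.

Lemma sa_prec r q (c : 'rV[R]_q -> 'rV[R]_1) (x : 'rV[R]_q -> 'rV[R]_n)
    (v : 'rV[R]_q -> 'rV[R]_m) :
  polynomial_map c -> polynomial_map x -> polynomial_map v ->
  semialgebraic_set (fun w => prec r (c w 0 0) (x w) (v w)).
Proof.
elim: r q c x v => [|r IHr] q c x v pc px pv /=; first exact: sa_Z.
apply: sa_and; first exact: sa_Z.
apply: (sa_exists (P := fun w v' => prec r (c w 0 0) (x w) v' /\
   moment (c w 0 0) v' < moment (c w 0 0) (v w))).
have px' := polynomial_map_comp_lsub m px; have pc' := polynomial_map_comp_lsub m pc.
have pv' := polynomial_map_comp_lsub m pv; have pz := @polynomial_map_rsub_id R q m.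
apply: sa_and; first exact: IHr.
by apply: sa_lt; apply: polynomial_moment.
Qed.

Lemma sa_link q (x : 'rV[R]_q -> 'rV[R]_n) (v : 'rV[R]_q -> 'rV[R]_m)
    (x' : 'rV[R]_q -> 'rV[R]_n) (v' : 'rV[R]_q -> 'rV[R]_m) :
  polynomial_map x -> polynomial_map v -> polynomial_map x' -> polynomial_map v' ->
  semialgebraic_set (fun w => link (x w) (v w) (x' w) (v' w)).
Proof.
move=> px pv px' pv'; apply: sa_and; first by apply: sa_and; apply: sa_Z.
apply: (sa_exists (P := fun w (c : 'rV[R]_1) => (forall t : 'rV[R]_1,
    0 <= t 0 0 /\ t 0 0 <= 1 ->
       separates (c 0 0) (x w + t 0 0 *: (x' w - x w))) /\
    (forall r : 'I_M.+1, prec r (c 0 0) (x w) (v w) <-> prec r (c 0 0) (x' w) (v' w)))).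
apply: sa_and; last first.
  apply: sa_bigand => r; apply: sa_iff; apply: sa_prec;
    solve [exact: polynomial_map_comp_lsub | exact: polynomial_map_rsub_id].
apply: (sa_forall (P := fun w (t : 'rV[R]_1) => 0 <= t 0 0 /\ t 0 0 <= 1 ->
  separates (rsubmx w 0 0) (x (lsubmx w) + t 0 0 *: (x' (lsubmx w) - x (lsubmx w))))).
have pt := @polynomial_map_rsub_id R (q + 1) 1.
have pc := polynomial_map_comp_lsub 1 (@polynomial_map_rsub_id R q 1).
have px2 := polynomial_map_comp_lsub 1 (polynomial_map_comp_lsub 1 px).
have px2' := polynomial_map_comp_lsub 1 (polynomial_map_comp_lsub 1 px').
apply: sa_imply.
  by apply: sa_and; apply: sa_le; solve [exact: polynomial_fun_cst | exact: pt].
apply: sa_separates => //; apply: polynomial_mapD => //.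
apply: polynomial_mapZ; first exact: pt.
exact: polynomial_mapB.
Qed.

Lemma sa_chain k q (x : 'rV[R]_q -> 'rV[R]_n) (v : 'rV[R]_q -> 'rV[R]_m)
    (x' : 'rV[R]_q -> 'rV[R]_n) (v' : 'rV[R]_q -> 'rV[R]_m) :
  polynomial_map x -> polynomial_map v -> polynomial_map x' -> polynomial_map v' ->
  semialgebraic_set (fun w => chain k (x w) (v w) (x' w) (v' w)).
Proof.
elim: k q x v x' v' => [|k IHk] q x v x' v' px pv px' pv' /=.
  by apply: sa_and; apply: sa_eqmx.
apply: (sa_exists (P := fun w x'' => exists v'', link (x w) (v w) x'' v'' /\
  chain k x'' v'' (x' w) (v' w))).
apply: (sa_exists (P := fun w v'' => link (x (lsubmx w)) (v (lsubmx w)) (rsubmx w) v'' /\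
  chain k (rsubmx w) v'' (x' (lsubmx w)) (v' (lsubmx w)))).
have px'' := polynomial_map_comp_lsub m (@polynomial_map_rsub_id R q n).
have pv'' := @polynomial_map_rsub_id R (q + n) m.
apply: sa_and; [apply: sa_link | apply: IHk] => //;
  exact: polynomial_map_comp_lsub (polynomial_map_comp_lsub n _).
Qed.

(** * Generic choice of a separating functional *)

Lemma moment_continuous c : continuous (moment c).
Proof.
rewrite (_ : moment c = fun v => \sum_(j < m) c ^+ j * v 0 j) //.
apply: (@continuous_sum R 'rV[R]_m R) => j v.
by apply: (@continuousM R 'rV[R]_m (fun=> c ^+ j) (fun v => v 0 j));
  [exact: cst_continuous | exact: coord_continuous].
Qed.

(** A countable set is Lebesgue null, whereas [0, 1] has measure 1. *)
Lemma exists_notin_countable (A : set R) : countable A -> exists c, ~ A c.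
Proof.
move=> /countable_lebesgue_measure0 A0; apply: contrapT => /forallNP nA.
have AT : A = setT by apply/seteqP; split=> // c _; apply: contrapT.
pose I : set R := [set` `[0%R, 1%R]].
have : (lebesgue_measure I <= lebesgue_measure A)%E.
  by apply: le_measure; rewrite ?inE ?AT //; exact: measurable_itv.
by rewrite /I A0 lebesgue_measure_itv /= lte_fin ltr01 oppr0 adde0 lee_fin ler10.
Qed.

Lemma finite_not_separates x : finite_set [set c | ~ separates c x].
Proof.
(* The coefficients of [D ij] are the coordinates of the difference of the two sheets at [x];
   [insub] makes an ordinal of [k], and its default is never met for k < m. *)
pose D (ij : 'I_M * 'I_M) : {poly R} :=
  \poly_(k < m) (if insub k is Some k' then (y ij.1 x - y ij.2 x) 0 k' else 0).
have DE c ij : (D ij).[c] = moment c (y ij.1 x) - moment c (y ij.2 x).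
  rewrite horner_poly /moment -sumrB; apply: eq_bigr => k _.
  by rewrite valK !mxE mulrC mulrBr.
have D0 ij : ij.1 <> ij.2 -> D ij != 0.
  apply: contra_not_neq => /polyP D0; apply: (@y_inj x); apply/rowP => k.
  have := D0 k; rewrite coef_poly ltn_ord valK coef0 !mxE.
  by move/eqP; rewrite subr_eq0 => /eqP.
apply: (@sub_finite_set _ _ (\bigcup_(ij in [set ij | ij.1 <> ij.2]) [set c | root (D ij) c])).
  move=> c /existsNP[v /existsNP[v']].
  move=> /not_implyP[/y_graphs[i ->]] /not_implyP[/y_graphs[j ->]] /not_implyP[mij vij].
  exists (i, j) => /=; first by move=> ij; apply: vij; rewrite ij.
  by rewrite /root DE /= mij subrr.
apply: bigcup_finite; first exact: finite_finset.
move=> ij /D0 /root_list[s _ sP]; apply: sub_finite_set (finite_seq s).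
by move=> c /sP.
Qed.

Lemma exists_separates x : exists c, separates c x.
Proof.
have [|c /contrapT cx] := @exists_notin_countable [set c | ~ separates c x].
  exact/finite_set_countable/finite_not_separates.
by exists c.
Qed.

(* The bad parameters [t] of such a [c] on the line through [x] contain no
   rational number, hence no interval. *)
Lemma exists_separates_rat x : exists c, forall q : rat, separates c (ratr q *: x).
Proof.
have [|c /= nc] := @exists_notin_countable
    (\bigcup_(q in [set: rat]) [set c | ~ separates c (ratr q *: x)]).
  apply: bigcup_countable => [|q _]; first exact: countableP.
  exact/finite_set_countable/finite_not_separates.
by exists c => q; apply: contrapT => nq; apply: nc; exists q.
Qed.

Lemma sheet_moment_continuous c i x d :
  continuous (fun t : R => moment c (y i (x + t *: d))).
Proof.
move=> t; apply: (@continuous_comp _ _ _ (fun t : R => y i (x + t *: d)) (moment c)).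
  apply: (@continuous_comp _ _ _ (fun t : R => x + t *: d) (y i)).
    exact: line_continuous.
  exact: y_continuous.
exact: moment_continuous.
Qed.

Section Segment.
Variables (c : R) (x x' : 'rV[R]_n).
Hypothesis good : forall t : R, 0 <= t <= 1 -> separates c (x + t *: (x' - x)).

Let good0 : separates c x.
Proof. by have := good (t := 0); rewrite scale0r addr0; apply; rewrite lexx ler01. Qed.

(** Two sheets whose order changed would have equal moments at some point of the segment by the
    intermediate value theorem; as [c] separates there, they would be the same sheet. *)
Lemma moment_lt_segment i j :
  moment c (y i x) < moment c (y j x) -> moment c (y i x') < moment c (y j x').
Proof.
move=> ij0; rewrite ltNge; apply/negP => ji1.
pose f t := moment c (y j (x + t *: (x' - x))) - moment c (y i (x + t *: (x' - x))).
have f0 : 0 < f 0 by rewrite /f scale0r addr0 subr_gt0.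
have f1 : f 1 <= 0 by rewrite /f scale1r [x + _]addrC subrK subr_le0.
have cf : continuous f.
  by move=> t; apply: cvgB; apply: sheet_moment_continuous.
have [||t] := @IVT R f 0 1 0 ler01.
- exact: continuous_subspaceT.
- by rewrite ge_min f1 orbT /= le_max (ltW f0).
rewrite in_itv /= => t01 /eqP; rewrite subr_eq0 => /eqP/(good t01 (Zy _ _) (Zy _ _)).
by move=> /y_inj ji; move: ij0; rewrite ji ltxx.
Qed.

Lemma moment_lt_segment_iff i j :
  moment c (y i x) < moment c (y j x) <-> moment c (y i x') < moment c (y j x').
Proof.
split=> [|ij']; first exact: moment_lt_segment.
case: (ltgtP (moment c (y i x)) (moment c (y j x))) => // [/moment_lt_segment ji'|].
  by move: (lt_trans ij' ji'); rewrite ltxx.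
by move=> /(good0 (Zy _ _) (Zy _ _))/y_inj ij; move: ij'; rewrite ij ltxx.
Qed.

Lemma prec_segment r i : prec r c x (y i x) <-> prec r c x' (y i x').
Proof.
elim: r i => [|r IHr] i /=; first by split=> _; apply: Zy.
split=> -[_ [v [pv lv]]]; split; try exact: Zy.
  have /y_graphs[j vj] : Z x v by case: r pv {IHr} => [|r] // [].
  by exists (y j x'); rewrite vj in pv lv; split; [apply/IHr|apply/moment_lt_segment_iff].
have /y_graphs[j vj] : Z x' v by case: r pv {IHr} => [|r] // [].
by exists (y j x); rewrite vj in pv lv; split; [apply/IHr|apply/moment_lt_segment_iff].
Qed.

End Segment.

Lemma link_same c x x' i :
  (forall t : R, 0 <= t <= 1 -> separates c (x + t *: (x' - x))) ->
  link x (y i x) x' (y i x').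
Proof.
move=> good; split; first by split; apply: Zy.
exists c%:M; split=> [t /andP t01|r]; rewrite mxE mulr1n; first exact: good.
exact: prec_segment.
Qed.

Lemma prec_chain r c x v : prec r c x v ->
  exists s : seq 'I_M, [/\ uniq s, size s = r.+1 &
    forall k, k \in s -> moment c (y k x) <= moment c v].
Proof.
elim: r v => [|r IHr] v /=.
  move=> /y_graphs[i ->]; exists [:: i]; split=> // k.
  by rewrite inE => /eqP->.
move=> [/y_graphs[i vi] [v' [/IHr[s [us ss sP]] lv]]]; exists (i :: s).
split=> [|/=|k]; last 2 first.
- by rewrite ss.
- by rewrite inE => /orP[/eqP->|/sP kv]; [rewrite vi | rewrite (le_trans kv) // ltW].
rewrite /= us andbT; apply/negP => /sP; rewrite -vi => vv'.
by move: (le_lt_trans vv' lv); rewrite ltxx.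
Qed.

(** Rank r of [v] gives rank r + 1 of [v'], hence of [v] by assumption. Climbing up to rank M yields
    M + 1 distinct sheets among M, which is why ranks run over ['I_M.+1]. *)
Lemma prec_lt c x v v' : Z x v -> Z x v' -> moment c v < moment c v' ->
  (forall r : 'I_M.+1, prec r c x v' -> prec r c x v) -> False.
Proof.
move=> Zv Zv' vv' P.
have all_prec r : (r <= M)%N -> prec r c x v.
  elim: r => [|r IHr] rM //.
  by apply: (P (Ordinal (rM : r.+1 < M.+1)%N)); split=> //; exists v; split=> //; apply/IHr/ltnW.
have [s [us ss _]] := prec_chain (all_prec M (leqnn M)).
have := max_card (mem s); rewrite card_ord (card_uniqP us) ss.
by rewrite ltnn.
Qed.

(** The rank of [y i x] is carried along its own sheet to [x'], which leaves two points of one fibre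
    having the same ranks. *)
Lemma link_eq x x' i j : link x (y i x) x' (y j x') -> i = j.
Proof.
move=> [_ [c [good P]]].
have {}good (t : R) : 0 <= t <= 1 -> separates (c 0 0) (x + t *: (x' - x)).
  by move=> /andP t01; have := good t%:M; rewrite mxE mulr1n; apply.
have {}P r : (r < M.+1)%N ->
    prec r (c 0 0) x' (y i x') <-> prec r (c 0 0) x' (y j x').
  by move=> rM; rewrite -(prec_segment good); apply: (P (Ordinal rM)).
have good1 : separates (c 0 0) x'.
  by have := good 1; rewrite scale1r [x + _]addrC subrK; apply; rewrite lexx ler01.
case: (ltgtP (moment (c 0 0) (y i x')) (moment (c 0 0) (y j x'))) => [lt_ij|lt_ji|].
- by case: (prec_lt (Zy _ _) (Zy _ _) lt_ij) => r /P; apply; apply: ltn_ord.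
- by case: (prec_lt (Zy _ _) (Zy _ _) lt_ji) => r /P; apply; apply: ltn_ord.
- by move=> /(good1 _ _ (Zy _ _) (Zy _ _))/y_inj.
Qed.

(** * Chains along a sheet *)

Lemma link_refl x i : link x (y i x) x (y i x).
Proof.
have [c cx] := exists_separates x; apply: (@link_same c) => t _.
by rewrite subrr scaler0 addr0.
Qed.

(** Chains have an exact length; this pads the shorter ones. *)
Lemma chain_refl k x i : chain k x (y i x) x (y i x).
Proof. by elim: k => //= k IHk; exists x, (y i x); split; [apply: link_refl|]. Qed.

Lemma chain_cat k l x v x' v' x'' v'' :
  chain k x v x' v' -> chain l x' v' x'' v'' -> chain (k + l) x v x'' v''.
Proof.
elim: k x v => [|k IHk] x v /=; first by move=> [-> ->].
move=> [a [b [xa ab]]] c; exists a, b; split=> //; exact: IHk ab c.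
Qed.

(** Soundness of chains: each intermediate point lies on some sheet, which [link_eq] identifies with
    the previous one. *)
Lemma chain_eq k x x' i v : chain k x (y i x) x' v -> v = y i x'.
Proof.
elim: k x i => [|k IHk] x i /=; first by move=> [-> <-].
move=> [x'' [v'' [xv c]]]; have [[_ /y_graphs[l vl]] _] := xv.
by rewrite vl in xv c; rewrite (link_eq xv); exact: IHk c.
Qed.

(** This is 2^(N+1) - 1: one link crosses a bad parameter, and the remaining ones are all counted
    again on each side, so that their list need not be split. *)
Fixpoint chain_length (N : nat) : nat :=
  if N is N'.+1 then chain_length N' + (1 + chain_length N') else 1.

(** Only finitely many differences of moments, continuous and nonzero at [b], have to stay nonzero.
    The [0 +] below gives lines the form used in [sheet_moment_continuous]. *)
Lemma separates_nbhs c x (b : R) : separates c (b *: x) ->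
  \forall t \near b, separates c (t *: x).
Proof.
move=> cb; pose P (ij : 'I_M * 'I_M) (t : R) :=
  ij.1 != ij.2 -> moment c (y ij.1 (0 + t *: x)) - moment c (y ij.2 (0 + t *: x)) != 0.
have H : \forall t \near b, forall ij, P ij t.
  apply: (@filter_forall _ _ P (nbhs b)) => -[i j]; rewrite /P /=.
  have [_|ij] := eqVneq i j; first by near=> t.
  have cf : {for b, continuous (fun t : R => moment c (y i (0 + t *: x)) - moment c (y j (0 + t *: x)))}.
    by apply: cvgB; apply: sheet_moment_continuous.
  have /(cvgr_neq0 _ cf) : moment c (y i (0 + b *: x)) - moment c (y j (0 + b *: x)) != 0.
    rewrite !add0r subr_eq0; apply: contra_neq ij.
    by move=> /(cb _ _ (Zy _ _) (Zy _ _))/y_inj.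
  by apply: filterS => t nt _.
near=> t => v v' /y_graphs[i ->] /y_graphs[j ->] mij.
have [->//|ij] := eqVneq i j; exfalso; move: mij; apply/eqP; rewrite -subr_eq0.
rewrite -[t *: x]add0r; suff h : forall ij, P ij t by exact: (h (i, j)).
by near: t.
Unshelve. all: by end_near. Qed.

(* Around a bad parameter [d] of [c], one switches to some [c'] which separates
   the fibre over [d *: x]. *)
Lemma chain_segment N c x i (a b : R) (s : seq R) : a <= b -> (size s <= N)%N ->
  (forall t, a <= t <= b -> ~ separates c (t *: x) -> t \in s) ->
  chain (chain_length N) (a *: x) (y i (a *: x)) (b *: x) (y i (b *: x)).
Proof.
elim: N a b s => [|N IHN] a b s ab sN sP.
  exists (b *: x), (y i (b *: x)); split=> //; apply: (@link_same c) => t /andP[t0 t1].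
  apply: contrapT => nt; suff : a + t * (b - a) \in s by case: s sN {sP}.
  apply: sP; last by rewrite scalerDl -scalerA scalerBl.
  apply/andP; split; nra.
have [[d /andP[ad db] nd]|good] :=
    pselect (exists2 d, a <= d <= b & ~ separates c (d *: x)); last first.
  apply: (@chain_cat (chain_length N) (1 + chain_length N) _ _ (b *: x) (y i (b *: x))).
    apply: (IHN _ _ [::]) => // t abt nt.
    by case: good; exists t.
  exact: chain_refl.
have ds : d \in s by apply: sP => //; rewrite ad.
pose s' := [seq t <- s | t != d].
have s'N : (size s' <= N)%N.
  rewrite -ltnS (leq_trans _ sN) // size_filter -(count_predC (pred1 d)) addnC.
  by rewrite -addn1 leq_add // -has_count has_pred1.
have [c' c'd] := exists_separates (d *: x).
have [e e0 de] : exists2 e, 0 < e & forall t, d - e <= t <= d + e -> separates c' (t *: x).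
  have /nbhs_ballP[e /= e0 de] := separates_nbhs c'd; exists (e / 2); first by rewrite divr_gt0.
  move=> t /andP[t1 t2]; apply: de; rewrite /ball /= ltr_norml; apply/andP; split; lra.
(* One link with [c'] crosses [a', b'], the part of [a, b] within [e] of [d]. The bad parameters of
   [c] on the remaining sides differ from [d], hence lie in [s']. *)
pose a' := Num.max a (d - e); pose b' := Num.min b (d + e).
have aa' : a <= a' by rewrite le_max lexx.
have b'b : b' <= b by rewrite ge_min lexx.
have a'd : a' <= d by rewrite ge_max ad /=; lra.
have db' : d <= b' by rewrite le_min db /=; lra.
apply: (@chain_cat _ _ _ _ (a' *: x) (y i (a' *: x))).
  have [le_ade|lt_ade] := leP (d - e) a.
    by rewrite /a' (max_idPl le_ade); exact: chain_refl.
  apply: (IHN _ _ s') => // t /andP[at_ ta'] nt; rewrite mem_filter sP ?at_ //=; last lra.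
  by rewrite andbT lt_eqF // (le_lt_trans ta') // /a' (max_idPr (ltW lt_ade)); lra.
apply: (@chain_cat _ _ _ _ (b' *: x) (y i (b' *: x))).
  exists (b' *: x), (y i (b' *: x)); split=> //; apply: (@link_same c') => t /andP[t0 t1].
  rewrite -scalerBl scalerA -scalerDl; apply: de.
  have : d - e <= a' by rewrite le_max lexx orbT.
  have : b' <= d + e by rewrite ge_min lexx orbT.
  by move=> h1 h2; apply/andP; split; nra.
have [le_bde|lt_bde] := leP b (d + e).
  by rewrite /b' (min_idPl le_bde); exact: chain_refl.
apply: (IHN _ _ s') => // t /andP[bt tb] nt; rewrite mem_filter sP ?tb ?andbT //=; last lra.
by rewrite gt_eqF // (lt_le_trans _ bt) // /b' (min_idPr (ltW lt_bde)); lra.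
Qed.

Lemma sheet_semialgebraic i : semialgebraic_map (y i).
Proof.
have [K KP] : exists K, forall (w : 'rV[R]_(n + 1)),
    (forall a b, a < b -> exists t, a < t < b /\ ~ ~ separates (rsubmx w 0 0) (t *: lsubmx w)) ->
    exists2 s : seq R, (size s <= K)%N &
      forall t, ~ separates (rsubmx w 0 0) (t *: lsubmx w) -> t \in s.
  apply: (semialgebraic_uniform_finiteness (A := fun w t =>
    ~ separates (rsubmx w 0 0) (t *: lsubmx w))).
  apply: sa_not; have pid := @polynomial_map_id R (n + 1 + 1).
  apply: (@sa_separates _ (fun w => rsubmx (lsubmx w))).
    exact/polynomial_map_rsub/polynomial_map_lsub.
  apply: polynomial_mapZ; last by do 2!apply: polynomial_map_lsub.
  exact: (polynomial_map_rsub pid).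
have sC : semialgebraic_set (fun w : 'rV_(n + m) =>
    chain (chain_length K) 0 (y i 0) (lsubmx w) (rsubmx w)).
  have pid := @polynomial_map_id R (n + m).
  apply: sa_chain; try exact: polynomial_map_cst; first exact: polynomial_map_lsub.
  exact: polynomial_map_rsub.
apply: sa_ext sC => w; split=> [C|[x _ <-]]; last first.
  rewrite row_mxKl row_mxKr.
  have [c cx] := exists_separates_rat x.
  have [|s sK sP] := KP (row_mx x c%:M).
    (* By the choice of [c], any rational number between [a] and [b] is a good parameter. *)
    move=> a b ab; have [q] := rat_in_itvoo ab; rewrite in_itv /= => abq.
    exists (ratr q); split=> //; apply; rewrite row_mxKl row_mxKr mxE mulr1n.
    exact: cx.
  have := @chain_segment K c x i 0 1 s; rewrite scale0r scale1r; apply=> // t _ nt.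
  by apply: sP; rewrite row_mxKl row_mxKr mxE mulr1n.
by exists (lsubmx w) => //; rewrite -(chain_eq C) hsubmxK.
Qed.

End Sheets.

(** * The critical set is semi-algebraic *)

(** As [g] is not polynomial, its value is replaced by a new variable, bound existentially and tied
    to [g] by its graph. *)
Lemma sa_comp_fun (R : realType) p q (g : 'rV[R]_q -> R) (phi : 'rV[R]_p -> 'rV[R]_q)
    (P : 'rV[R]_p -> R -> Prop) :
  semialgebraic_fun g -> polynomial_map phi ->
  semialgebraic_set (fun w : 'rV_(p + 1) => P (lsubmx w) (rsubmx w 0 0)) ->
  semialgebraic_set (fun x => P x (g (phi x))).
Proof.
move=> sg pphi sP.
apply: (@sa_ext _ _ (fun x => exists r : 'rV[R]_1,
    [set row_mx z (\row_(_ < 1) g z) | z in setT] (row_mx (phi x) r) /\ P x (r 0 0))).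
  move=> x; split=> [[r [[z _ /eq_row_mx[<- <-]]]]|Px]; first by rewrite mxE.
  by exists (\row_(_ < 1) g (phi x)); split; [exists (phi x) | rewrite mxE].
apply: sa_exists; apply: sa_and sP; apply: sa_preimage sg _.
have pid := @polynomial_map_id R (p + 1).
apply: polynomial_map_row; last exact: polynomial_map_rsub.
by apply: (polynomial_map_comp pphi); apply: polynomial_map_lsub.
Qed.

Section DeriveEq0.
Variables (R : realType) (V : normedModType R).

(** The definition of the limit in polynomial form: absolute values are squared, so that [e] and [d]
    stand for the squares of the usual bounds, and the quotient is cleared, which makes h = 0
    harmless. *)
Lemma derive_eq0P (f : V -> R) (a v : V) : derivable f a v ->
  'D_v f a = 0 <-> forall e : R, 0 < e -> exists d : R, 0 < d /\
    forall h : R, h ^+ 2 < d -> (f (h *: v + a) - f a) ^+ 2 <= e * h ^+ 2.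
Proof.
move=> fav; have qD : h^-1 *: (f (h *: v + a) - f a) @[h --> 0^'] --> 'D_v f a.
  exact: fav.
split=> [D0 e e0|H].
  rewrite D0 in qD; have /cvgr0Pnorm_lt/(_ (Num.sqrt e)) := qD.
  rewrite sqrtr_gt0 => /(_ e0) /nbhs_ballP[d /= d0 dP].
  exists (d ^+ 2); split=> [|h hd]; first by rewrite exprn_gt0.
  have [->|h0] := eqVneq h 0; first by rewrite scale0r add0r subrr expr0n /= mulr0.
  have hd' : `|h| < d.
    by rewrite -(@ltr_pXn2r _ 2) ?nnegrE ?(ltW d0) // real_normK ?num_real.
  have := dP h; rewrite /ball /= sub0r normrN => /(_ hd' h0).
  rewrite normrZ normfV ltr_pdivrMl ?normr_gt0 // => /ltW.
  rewrite -(@ler_pXn2r _ 2) ?nnegrE ?mulr_ge0 ?sqrtr_ge0 //.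
  by rewrite exprMn !real_normK ?num_real // sqr_sqrtr ?(ltW e0) // mulrC.
suff q0 : h^-1 *: (f (h *: v + a) - f a) @[h --> 0^'] --> (0 : R).
  exact: cvg_unique qD q0.
apply/cvgr0Pnorm_le => e e0; have [d [d0 dP]] := H _ (exprn_gt0 2 e0).
apply/nbhs_ballP; exists (Num.sqrt d); rewrite /= ?sqrtr_gt0 // => h.
rewrite /ball /= sub0r normrN => hd h0.
rewrite normrZ normfV ler_pdivrMl ?normr_gt0 // -(@ler_pXn2r _ 2) ?nnegrE ?mulr_ge0 ?(ltW e0) //.
rewrite exprMn !real_normK ?num_real // mulrC; apply: dP.
by rewrite -(real_normK (num_real h)) -[ltRHS]sqr_sqrtr ?(ltW d0) // ltr_pXn2r ?nnegrE ?sqrtr_ge0.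
Qed.

End DeriveEq0.

Lemma sa_crit (R : realType) n m (g : 'rV[R]_(n + m) -> R) : semialgebraic_fun g ->
  (forall x y, differentiable (slice g x) y) ->
  semialgebraic_set (fun w : 'rV_(n + m) => crit (slice g (lsubmx w)) (rsubmx w)).
Proof.
move=> sg dg.
apply: (@sa_ext _ _ (fun w => forall i : 'I_m, forall e : 'rV[R]_1, 0 < e 0 0 ->
  exists d : 'rV[R]_1, 0 < d 0 0 /\ forall h : 'rV[R]_1, h 0 0 ^+ 2 < d 0 0 ->
  (g (row_mx (lsubmx w) (h 0 0 *: delta_mx 0 i + rsubmx w)) - g w) ^+ 2 <= e 0 0 * h 0 0 ^+ 2)).
  move=> w; transitivity (forall i, partial i (slice g (lsubmx w)) (rsubmx w) = 0); last first.
    split=> [H|/rowP H i]; first by apply/rowP => i; rewrite !mxE.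
    by have := H i; rewrite !mxE.
  split=> H i.
    apply/derive_eq0P; first exact: diff_derivable.
    move=> e e0; have [|d [d0 dP]] := H i e%:M; first by rewrite mxE mulr1n.
    exists (d 0 0); split=> // h hd; have := dP h%:M; rewrite /slice hsubmxK !mxE !mulr1n.
    exact.
  move=> e e0; have /derive_eq0P : derivable (slice g (lsubmx w)) (rsubmx w) (delta_mx 0 i).
    exact: diff_derivable.
  move=> [/(_ (H i)) /(_ _ e0)[d [d0 dP]] _]; exists d%:M; rewrite mxE mulr1n; split=> // h hd.
  by have := dP _ hd; rewrite /slice hsubmxK.
apply: sa_bigand => i; apply: sa_forall; apply: sa_imply.
  by apply: sa_gt0; apply: polynomial_map_rsub; apply: polynomial_map_id.
apply: sa_exists; have pid3 := @polynomial_map_id R (n + m + 1 + 1 + 1).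
apply: sa_and.
  by apply: sa_gt0; apply: polynomial_map_rsub; apply: polynomial_map_id.
apply: sa_forall; apply: sa_imply.
  apply: sa_lt; first by apply: polynomial_funX; apply: polynomial_map_rsub.
  by apply: polynomial_map_rsub; apply: polynomial_map_lsub.
have pw : polynomial_map (fun w : 'rV[R]_(n + m + 1 + 1 + 1) => lsubmx (lsubmx (lsubmx w))).
  by do 3!apply: polynomial_map_lsub.
(* The coordinates of [w] are the base point, then e, d and h. The values of [g] at the displaced
   point and then at the base point become two further coordinates. *)
apply: (sa_comp_fun (phi := fun w : 'rV[R]_(n + m + 1 + 1 + 1) =>
    row_mx (lsubmx (lsubmx (lsubmx (lsubmx w))))
      (rsubmx w 0 0 *: delta_mx 0 i + rsubmx (lsubmx (lsubmx (lsubmx w)))))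
  (P := fun w r => (r - g (lsubmx (lsubmx (lsubmx w)))) ^+ 2 <=
     rsubmx (lsubmx (lsubmx w)) 0 0 * rsubmx w 0 0 ^+ 2)) => //.
  apply: polynomial_map_row; first exact: polynomial_map_lsub.
  apply: polynomial_mapD; last exact: polynomial_map_rsub.
  by apply: polynomial_mapZ; [apply: polynomial_map_rsub | apply: polynomial_map_cst].
have pid4 := @polynomial_map_id R (n + m + 1 + 1 + 1 + 1).
have pid5 := @polynomial_map_id R (n + m + 1 + 1 + 1 + 1 + 1).
apply: (sa_comp_fun (phi := fun w : 'rV[R]_(n + m + 1 + 1 + 1 + 1) =>
    lsubmx (lsubmx (lsubmx (lsubmx w))))
  (P := fun w r => (rsubmx w 0 0 - r) ^+ 2 <=
     rsubmx (lsubmx (lsubmx (lsubmx w))) 0 0 * rsubmx (lsubmx w) 0 0 ^+ 2)) => //.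
  by do 4!apply: polynomial_map_lsub.
apply: sa_le.
  apply: polynomial_funX; apply: polynomial_funB; last exact: polynomial_map_rsub.
  by apply: polynomial_map_rsub; apply: polynomial_map_lsub.
apply: polynomial_funM.
  by apply: polynomial_map_rsub; do 4!apply: polynomial_map_lsub.
apply: polynomial_funX; apply: polynomial_map_rsub; do 2!apply: polynomial_map_lsub.
exact: pid5.
Qed.

(** * Strict differentiability *)

Section RowNorm.
Variable R : realType.

Lemma norm_entry_le n (x : 'rV[R]_n) i : `|x 0 i| <= `|x|.
Proof.
by rewrite [leRHS]/Num.norm /= mx_normrE; apply: (le_bigmax _ (fun ij => `|x ij.1 ij.2|) (0, i)).
Qed.

Lemma norm_row_le n (x : 'rV[R]_n) e : 0 <= e -> (forall i, `|x 0 i| <= e) -> `|x| <= e.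
Proof.
move=> e0 xe; rewrite [leLHS]/Num.norm /= mx_normrE; apply/bigmax_leP; split=> // -[i j] _ /=.
by rewrite ord1.
Qed.

Lemma norm_mulmx_bounded p q (A : 'M[R]_(p, q)) :
  exists2 C, 0 < C & forall v : 'rV_p, `|v *m A| <= C * `|v|.
Proof.
(* The 1 keeps the constant positive for a zero or empty matrix, so that one may divide by it. *)
exists (1 + \sum_j \sum_i `|A i j|) => [|v].
  by rewrite ltr_pwDl // sumr_ge0 // => j _; rewrite sumr_ge0.
apply: norm_row_le => [|j].
  by rewrite mulr_ge0 // addr_ge0 // sumr_ge0 // => j _; rewrite sumr_ge0.
rewrite mxE (le_trans (ler_norm_sum _ _ _)) //.
rewrite (@le_trans _ _ (\sum_i `|A i j| * `|v|)) //.
  apply: ler_sum => i _; rewrite normrM mulrC ler_wpM2l //; exact: norm_entry_le.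
rewrite -mulr_suml ler_wpM2r // ler_wpDl // (bigD1 j) //= lerDl.
by apply: sumr_ge0 => k _; rewrite sumr_ge0.
Qed.

Lemma norm_row_mx_le n m (h : 'rV[R]_n) (k : 'rV[R]_m) e :
  `|h| <= e -> `|k| <= e -> `|row_mx h k| <= e.
Proof.
move=> he ke; apply: norm_row_le => [|i]; first exact: le_trans he.
rewrite mxE; case: splitP => j _; rewrite (le_trans (norm_entry_le _ _)) //.
Qed.

Lemma norm_rsubmx_le n m (w : 'rV[R]_(n + m)) : `|rsubmx w| <= `|w|.
Proof. by apply: norm_row_le => // i; rewrite mxE norm_entry_le. Qed.

Lemma continuous_rowP (T : topologicalType) n (f : T -> 'rV[R]_n) (x : T) :
  {for x, continuous f} <-> forall j, {for x, continuous (fun t => f t 0 j)}.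
Proof.
split=> [cf j|cf].
  apply: (@continuous_comp _ _ _ f (fun v : 'rV[R]_n => v 0 j)) => //.
  exact: coord_continuous.
apply/cvgrPdist_le => e e0; have H j : \forall t \near x, `|f x 0 j - f t 0 j| <= e.
  by have /cvgrPdist_le/(_ e e0) := cf j.
have : \forall t \near x, forall j, `|f x 0 j - f t 0 j| <= e.
  exact: (@filter_forall _ _ (fun j t => `|f x 0 j - f t 0 j| <= e)).
apply: filterS => t ft; apply: norm_row_le => [|j]; first exact: ltW.
by rewrite !mxE.
Qed.

End RowNorm.

Section Lines.
Variable R : realType.

Lemma is_derive_line (V W : normedModType R) (f : V -> W) (a u : V) (t : R) :
  derivable f (a + t *: u) u ->
  is_derive t (1 : R) (fun s : R => f (a + s *: u)) ('D_u f (a + t *: u)).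
Proof.
move=> df; have E : (fun h : R => h^-1 *: (((fun s : R => f (a + s *: u)) \o shift t) (h *: (1 : R)) -
    f (a + t *: u))) = (fun h => h^-1 *: ((f \o shift (a + t *: u)) (h *: u) - f (a + t *: u))).
  apply/funext => h /=; congr (_ *: (f _ - _)).
  by rewrite [_ *: 1]mulr1 scalerDl addrCA.
by split; rewrite /derivable /derive E.
Qed.

Lemma mean_value_line (V : normedModType R) (f : V -> R) (a u : V) :
  (forall t : R, 0 <= t <= 1 -> derivable f (a + t *: u) u) ->
  exists2 t : R, 0 < t < 1 & f (a + u) - f a = 'D_u f (a + t *: u).
Proof.
move=> df; pose phi (t : R) := f (a + t *: u).
have dphi (t : R) : 0 <= t <= 1 -> is_derive t 1 phi ('D_u f (a + t *: u)).
  by move=> t01; apply: is_derive_line; apply: df.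
have [|||t] := @MVT R phi (fun t => 'D_u f (a + t *: u)) 0 1.
- exact: ltr01.
- by move=> t; rewrite in_itv /= => /andP[t0 t1]; apply: dphi; rewrite !ltW.
- apply: derivable_within_continuous => t; rewrite in_itv /= => /dphi[]; exact.
rewrite in_itv /= => t01 E; exists t => //; move: E.
by rewrite /phi scale1r scale0r addr0 subr0 mulr1.
Qed.

Lemma derive_row_sum p (f : 'rV[R]_p -> R) w u : differentiable f w ->
  'D_u f w = \sum_i u 0 i * 'D_(delta_mx 0 i) f w.
Proof.
move=> df; rewrite deriveE // {1}(row_sum_delta u) raddf_sum /=.
by apply: eq_bigr => i _; rewrite linearZ deriveE.
Qed.

End Lines.

(** Rows are indexed by the directions, contrary to the usual convention: differentials act on row
    vectors, as [v *m jac F w]. *)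
Definition jac (R : realType) p q (F : 'rV[R]_p -> 'rV[R]_q) (w : 'rV[R]_p) : 'M[R]_(p, q) :=
  \matrix_(i, j) 'D_(delta_mx 0 i) (fun w => F w 0 j) w.

Section StrictDifferentiability.
Variables (R : realType) (p q : nat) (F : 'rV[R]_p -> 'rV[R]_q).
Hypothesis F_diff : forall j w, differentiable (fun w => F w 0 j) w.
Hypothesis F_C1 : forall j u, continuous (fun w => 'D_u (fun w => F w 0 j) w).

(** Mean value theorem for each component on the segment from [w'] to [w], which stays in a ball
    where the [p] partial derivatives vary by at most [e']. *)
Lemma strict_differentiability w0 (e : R) : 0 < e ->
  exists2 d, 0 < d & forall w w', `|w - w0| < d -> `|w' - w0| < d ->
    `|F w - F w' - (w - w') *m jac F w0| <= e * `|w - w'|.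
Proof.
move=> e0; pose e' := e / (1 + p%:R).
have p0 : 0 < 1 + p%:R :> R by rewrite ltr_pwDl.
have e'0 : 0 < e' by rewrite divr_gt0.
have : \forall w \near w0, forall ij : 'I_p * 'I_q,
    `|jac F w ij.1 ij.2 - jac F w0 ij.1 ij.2| <= e'.
  apply: (@filter_forall _ _ (fun ij w => `|jac F w ij.1 ij.2 - jac F w0 ij.1 ij.2| <= e') (nbhs w0)).
  move=> -[i j] /=; have /cvgrPdist_le/(_ _ e'0) := @F_C1 j (delta_mx 0 i) w0.
  by apply: filterS => w; rewrite !mxE distrC.
move=> /nbhs_ballP[d /= d0 dP]; exists d => // w w' ww0 w'w0.
apply: norm_row_le => [|j]; first by rewrite mulr_ge0 // ltW.
pose f w := F w 0 j.
have [t t01] : exists2 t : R, 0 < t < 1 & f (w' + (w - w')) - f w' = 'D_(w - w') f (w' + t *: (w - w')).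
  by apply: mean_value_line => t _; apply: diff_derivable; apply: F_diff.
rewrite [w' + (w - w')]addrC subrK => Ef; have df := F_diff j (w' + t *: (w - w')).
rewrite !mxE -/(f w) -/(f w') Ef derive_row_sum // -sumrB.
have tb : ball w0 d (w' + t *: (w - w')).
  rewrite -ball_normE /ball_ /= distrC.
  have -> : w' + t *: (w - w') - w0 = (1 - t) *: (w' - w0) + t *: (w - w0).
    by apply/rowP => k; rewrite !mxE; ring.
  move: t01 => /andP[t0 t1].
  rewrite (le_lt_trans (ler_normD _ _)) // !normrZ !ger0_norm ?subr_ge0 ?(ltW t0) ?(ltW t1) //.
  nra.
rewrite (le_trans (ler_norm_sum _ _ _)) //.
rewrite (@le_trans _ _ (\sum_(i < p) `|w - w'| * e')) //; last first.
  rewrite sumr_const card_ord -mulr_natr -mulrA mulrC ler_wpM2r //.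
  by rewrite /e' mulrAC ler_pdivrMr // ler_wpM2l ?(ltW e0) // ler_wpDl.
apply: ler_sum => i _; rewrite -mulrBr normrM ler_pM //; first exact: norm_entry_le.
by have := dP _ tb (i, j); rewrite !mxE.
Qed.

End StrictDifferentiability.

(** * Implicit functions *)

Section Approximation.
Variables (R : realType) (V W : normedModType R).

Lemma differentiable_approx (f : V -> W) (L : {linear V -> W}) (x : V) :
  continuous L ->
  (forall e, 0 < e -> exists2 d, 0 < d &
    forall h, `|h| < d -> `|f (x + h) - f x - L h| <= e * `|h|) ->
  differentiable f x /\ 'd f x = L :> (V -> W).
Proof.
move=> cL H; have E : f \o shift x = cst (f x) + L +o_ 0 id.
  apply/eqaddoP => e e0; have [d d0 dP] := H e e0.
  apply/nbhs_ballP; exists d => // h; rewrite -ball_normE /ball_ /= sub0r normrN => hd.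
  by rewrite !fctE /= opprD addrA [h + x]addrC; exact: dP.
have dfx := diff_unique cL E; split=> //.
by apply/diff_locallyP; rewrite dfx.
Qed.

Lemma differentiable_bound (f : V -> W) (x : V) : differentiable f x ->
  forall e, 0 < e -> exists2 d, 0 < d &
    forall h, `|h| < d -> `|f (x + h) - f x - 'D_h f x| <= e * `|h|.
Proof.
move=> df e e0; have /eqaddoP/(_ e e0)/nbhs_ballP[d d0 dP] := diff_locally df.
exists d => // h hd; have := dP h; rewrite -ball_normE /ball_ /= sub0r normrN => /(_ hd).
by rewrite !fctE /= opprD addrA [h + x]addrC deriveE.
Qed.

End Approximation.

Lemma nbhs_normP (R : realType) (V : normedModType R) (x : V) (P : set V) :
  nbhs x P <-> exists2 d, 0 < d & forall x', `|x' - x| < d -> P x'.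
Proof.
split=> [/nbhs_ballP[d /= d0 dP]|[d d0 dP]].
  by exists d => // x' xd; apply: dP; rewrite -ball_normE /ball_ /= distrC.
by apply/nbhs_ballP; exists d => // x'; rewrite -ball_normE /ball_ /= distrC => /dP.
Qed.

Lemma continuous_normP (R : realType) (V W : normedModType R) (f : V -> W) (x : V) :
  {for x, continuous f} <-> forall e, 0 < e ->
    exists2 d, 0 < d & forall x', `|x' - x| < d -> `|f x' - f x| <= e.
Proof.
split=> [cf e e0|H].
  by have /cvgrPdist_le/(_ e e0)/nbhs_normP[d d0 dP] := cf; exists d => // x' /dP; rewrite distrC.
apply/cvgrPdist_le => e e0; apply/nbhs_normP; have [d d0 dP] := H e e0.
by exists d => // x' /dP; rewrite distrC.
Qed.

Section RowSpace.
Variable R : realType.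

Lemma row_mxB n m (h h' : 'rV[R]_n) (k k' : 'rV[R]_m) :
  row_mx h k - row_mx h' k' = row_mx (h - h') (k - k').
Proof. by rewrite opp_row_mx add_row_mx. Qed.

Lemma continuous_row_mxl n m (y : 'rV[R]_m) : continuous (fun x : 'rV[R]_n => row_mx x y).
Proof.
move=> x; apply/continuous_normP => e e0; exists e => // x' xe.
by rewrite row_mxB subrr norm_row_mx_le ?normr0 // ltW.
Qed.

Lemma continuous_row_mxr n m (x : 'rV[R]_n) : continuous (fun y : 'rV[R]_m => row_mx x y).
Proof.
move=> y; apply/continuous_normP => e e0; exists e => // y' ye.
by rewrite row_mxB subrr norm_row_mx_le ?normr0 // ltW.
Qed.

Lemma continuous_mulmx p q (A : 'M[R]_(p, q)) : continuous (fun v : 'rV[R]_p => v *m A).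
Proof.
move=> v; apply/continuous_normP => e e0; have [C C0 CP] := norm_mulmx_bounded A.
exists (e / C) => [|v' ve]; first by rewrite divr_gt0.
by rewrite -mulmxBl (le_trans (CP _)) // mulrC -ler_pdivlMr // ltW.
Qed.

Lemma compact_norm_ball n (y : 'rV[R]_n) r : compact [set z : 'rV[R]_n | `|z - y| <= r].
Proof.
apply: bounded_closed_compact.
  exists (r + `|y|); split; first exact: num_real.
  move=> M ltM z /= zr; rewrite -[z](subrK y) (le_trans (ler_normD _ _)) //.
  by rewrite (le_trans _ (ltW ltM)) // lerD2r.
have -> : [set z : 'rV[R]_n | `|z - y| <= r] = closed_ball_ (fun z => `|z|) y r.
  by apply/seteqP; split=> z; rewrite /closed_ball_ /= distrC.
exact: closed_closed_ball_.
Qed.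

End RowSpace.

Section ImplicitFunction.
Variables (R : realType) (n m : nat) (F : 'rV[R]_(n + m) -> 'rV[R]_m).
Hypothesis F_diff : forall j w, differentiable (fun w => F w 0 j) w.
Hypothesis F_C1 : forall j u, continuous (fun w => 'D_u (fun w => F w 0 j) w).

Definition zeros (x : 'rV[R]_n) : set 'rV[R]_m := [set y | F (row_mx x y) = 0].

Hypothesis F_regular : forall x y, zeros x y -> dsubmx (jac F (row_mx x y)) \in unitmx.

Lemma differentiable_entries_continuous : continuous F.
Proof. by move=> w; apply/continuous_rowP => j; apply: differentiable_continuous. Qed.

(* Strict differentiability makes the chord map y - F(x, y) B^-1, with
   B the partial Jacobian at the base point, a 1/2-contraction in y. *)
Lemma chord_contraction x0 y0 : zeros x0 y0 ->
  let B := dsubmx (jac F (row_mx x0 y0)) in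
  exists2 d, 0 < d & forall x y y', `|x - x0| < d -> `|y - y0| < d -> `|y' - y0| < d ->
    `|(y - F (row_mx x y) *m invmx B) - (y' - F (row_mx x y') *m invmx B)| <= 2^-1 * `|y - y'|.
Proof.
move=> z0 B; have Bu : B \in unitmx by apply: F_regular.
have [C C0 CP] := norm_mulmx_bounded (invmx B).
(* Multiplication by [invmx B] costs a factor [C], which leaves the contraction ratio 1/2. *)
have [|d d0 dP] := strict_differentiability F_diff F_C1 (row_mx x0 y0) (e := (2 * C)^-1).
  by rewrite invr_gt0 mulr_gt0.
exists (d / 2) => [|x y y' xd yd y'd]; first by rewrite divr_gt0.
have dd : d / 2 < d by lra.
have b z : `|z - y0| < d / 2 -> `|row_mx x z - row_mx x0 y0| < d.
  by move=> zd; rewrite row_mxB (le_lt_trans _ dd) // norm_row_mx_le // ltW.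
have := dP _ _ (b _ yd) (b _ y'd).
rewrite row_mxB subrr -[jac F _]vsubmxK mul_row_col mul0mx add0r -/B.
set D := _ - _ *m B => DP.
have -> : y - F (row_mx x y) *m invmx B - (y' - F (row_mx x y') *m invmx B) = - (D *m invmx B).
  rewrite /D !mulmxBl -!mulmxA mulmxV // !mulmx1.
  move: (F (row_mx x y) *m _) (F (row_mx x y') *m _) => u u'.
  by apply/rowP => k; rewrite !mxE; ring.
rewrite normrN (le_trans (CP _)) // -ler_pdivlMl // (le_trans DP) //.
have -> : `|row_mx (0 : 'rV[R]_n) (y - y')| = `|y - y'|.
  apply/le_anti/andP; split; first by rewrite norm_row_mx_le ?normr0.
  by rewrite -{1}[y - y'](row_mxKr (0 : 'rV[R]_n)) norm_rsubmx_le.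
by rewrite invfM [2^-1 * C^-1]mulrC mulrA.
Qed.

(** Zeros are fixed points of the chord map, and a contraction has at most one. *)
Lemma zeros_locally_unique x0 y0 : zeros x0 y0 ->
  exists2 d, 0 < d & forall x y y', `|x - x0| < d -> `|y - y0| < d -> `|y' - y0| < d ->
    zeros x y -> zeros x y' -> y = y'.
Proof.
move=> z0; have [d d0 dP] := chord_contraction z0; exists d => // x y y' xd yd y'd zy zy'.
have := dP x y y' xd yd y'd; rewrite zy zy' !mul0mx !subr0 => H.
have {H} : `|y - y'| <= 0 by have := normr_ge0 (y - y'); lra.
by rewrite normr_le0 subr_eq0 => /eqP.
Qed.

Lemma zeros_locally_exist x0 y0 r : zeros x0 y0 -> 0 < r ->
  exists2 d, 0 < d & forall x, `|x - x0| < d -> exists2 y, `|y - y0| < r & zeros x y.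
Proof.
move=> z0 r0; have [d d0] := chord_contraction z0.
set B := dsubmx _ => dP; have Bu : B \in unitmx by apply: F_regular.
pose r' := Num.min (d / 2) (r / 2).
have r'0 : 0 < r' by rewrite lt_min !divr_gt0.
have r'd : r' < d by rewrite gt_min ltr_pdivrMr // ltr_pMr // ltr1n.
have r'r : r' < r by rewrite gt_min [r / 2 < r]ltr_pdivrMr // ltr_pMr // ltr1n orbT.
have [C C0 CP] := norm_mulmx_bounded (invmx B).
have cF : F (row_mx x y0) @[x --> x0] --> F (row_mx x0 y0).
  exact: (continuous_comp (@continuous_row_mxl _ _ _ y0 x0) (@differentiable_entries_continuous _)).
have := z0; rewrite /zeros /= => z0'.
(* For such [x], the map [T] below moves the centre [y0] by at most r' / 2; with the ratio 1/2, it
   sends the ball of radius [r'] into itself. *)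
have [|d' d'0 d'P] := (continuous_normP (fun x : 'rV[R]_n => F (row_mx x y0)) x0).1 cF (r' / (2 * C)).
  by rewrite divr_gt0 ?mulr_gt0.
rewrite z0' in d'P.
exists (Num.min d d') => [|x]; first by rewrite lt_min d0.
rewrite lt_min => /andP[xd xd'].
(* A minimum over the compact ball [U] of the displacement of the contraction [T]
   is a fixed point of [T]. *)
pose T y := y - F (row_mx x y) *m invmx B.
pose U := [set y : 'rV[R]_m | `|y - y0| <= r'].
have TL y y' : U y -> U y' -> `|T y - T y'| <= 2^-1 * `|y - y'|.
  by move=> Uy Uy'; apply: dP => //; exact: le_lt_trans r'd.
have U0 : U y0 by rewrite /U /= subrr normr0 ltW.
have T0 : `|T y0 - y0| <= r' / 2.
  rewrite /T addrAC subrr add0r normrN (le_trans (CP _)) //.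
  have := d'P x xd'; rewrite subr0.
  rewrite ler_pdivlMr ?mulr_gt0 // => h; lra.
have TU : forall y, U y -> U (T y).
  move=> y Uy; rewrite /U /= -[T y](subrK (T y0)) -addrA (le_trans (ler_normD _ _)) //.
  have := TL _ _ Uy U0; have : `|y - y0| <= r' by []. lra.
have cT : continuous (fun y => `|T y - y|).
  have -> : (fun y => `|T y - y|) = (fun y => `|F (row_mx x y) *m invmx B|).
    by apply/funext => y; rewrite /T addrAC subrr add0r normrN.
  have cG : continuous (fun y => F (row_mx x y) *m invmx B).
    move=> y; apply: (@continuous_comp _ _ _ (fun y => F (row_mx x y)) (mulmx^~ (invmx B))).
      exact: continuous_comp (@continuous_row_mxr _ _ _ x y) (@differentiable_entries_continuous _).
    exact: continuous_mulmx.
  by move=> y; apply: continuous_comp (cG y) (@norm_continuous _ _ _).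
have [||y /set_mem Uy ymin] := EVT_min_rV _ (@compact_norm_ball _ _ y0 r') (f := fun y => `|T y - y|).
- by exists y0.
- exact: continuous_subspaceT.
(* The displacement at [T y] is at most half of the one at [y], so a positive minimum is
   impossible. *)
have Ty : T y - y = 0.
  apply/eqP; rewrite -normr_le0; have := ymin (T y) (mem_set (TU _ Uy)).
  by move=> h; have := le_trans h (TL _ _ (TU _ Uy) Uy); lra.
exists y; first exact: le_lt_trans r'r.
have : F (row_mx x y) *m invmx B = 0.
  by apply/eqP; rewrite -oppr_eq0 -Ty /T addrAC subrr add0r.
move=> /(congr1 (mulmx^~ B)); rewrite -mulmxA mulVmx // mulmx1 mul0mx.
by [].
Qed.

Lemma zeros_closed x y : ~ zeros x y ->
  exists2 d, 0 < d & forall x' y', `|x' - x| < d -> `|y' - y| < d -> ~ zeros x' y'.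
Proof.
move=> nz; have F0 : 0 < `|F (row_mx x y)| by rewrite normr_gt0; apply/eqP.
have [|d d0 dP] := (continuous_normP F (row_mx x y)).1 (@differentiable_entries_continuous _) (`|F (row_mx x y)| / 2).
  by rewrite divr_gt0.
exists (d / 2) => [|x' y' xd yd z]; first by rewrite divr_gt0.
have := dP (row_mx x' y'); rewrite row_mxB z sub0r normrN => H.
have {}H : `|F (row_mx x y)| <= `|F (row_mx x y)| / 2.
  apply: H; rewrite (@le_lt_trans _ _ (d / 2)) ?norm_row_mx_le ?ltW //.
  by rewrite ltr_pdivrMr // ltr_pMr // ltr1n.
by move: F0 H; lra.
Qed.

(** As F vanishes along [s], the strict estimate bounds [h *m A + k *m B], where [k] is the
    increment of [s], by a small multiple of |h| + |k|. Since merely continuity of [s] is known, |k|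
    must first be bounded by a multiple of |h|. *)
Lemma section_differentiable (s : 'rV[R]_n -> 'rV[R]_m) :
  continuous s -> (forall x, zeros x (s x)) -> forall x,
  let J := jac F (row_mx x (s x)) in
  differentiable s x /\ forall v, 'D_v s x = v *m - (usubmx J *m invmx (dsubmx J)).
Proof.
move=> cs zs x J; set A := usubmx J; set B := dsubmx J.
have Bu : B \in unitmx by apply: F_regular.
have [C C0 CP] := norm_mulmx_bounded (invmx B).
have [C' C'0 C'P] := norm_mulmx_bounded (- (A *m invmx B)).
suff [ds Es] : differentiable s x /\ 'd s x = mulmxr (- (A *m invmx B)) :> ('rV_n -> 'rV_m).
  by split=> // v; rewrite deriveE // Es.
apply: differentiable_approx => [|e e0]; first exact: continuous_mulmx.
pose K := C * (2 + 2 * C').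
have K0 : 0 < K by rewrite mulr_gt0 // addr_gt0 // mulr_gt0.
(* The first bound makes C * eps at most 1/2, which absorbs |k| and gives |h| + |k| <= (2 + 2 C')
   |h|; the second one then yields the final error [e]. *)
pose eps := Num.min (2 * C)^-1 (e / K).
have eps0 : 0 < eps by rewrite lt_min invr_gt0 divr_gt0 // mulr_gt0.
have [d d0 dP] := strict_differentiability F_diff F_C1 (row_mx x (s x)) eps0.
have [|d' d'0 d'P] := (continuous_normP s x).1 (cs x) (d / 2); first by rewrite divr_gt0.
exists (Num.min (d / 2) d') => [|h]; first by rewrite lt_min divr_gt0.
rewrite lt_min => /andP[hd hd']; pose k := s (x + h) - s x.
have kd : `|k| <= d / 2 by apply: d'P; rewrite addrAC subrr add0r.
have := dP (row_mx (x + h) (s (x + h))) (row_mx x (s x)); rewrite !zs [0 - 0]subr0 sub0r normrN.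
rewrite [row_mx x (s x) - row_mx x (s x)]subrr normr0 row_mxB.
rewrite -/k [x + h - x]addrAC subrr add0r -[jac F _]vsubmxK mul_row_col -/J -/A -/B.
have d2 : d / 2 < d by rewrite ltr_pdivrMr // ltr_pMr // ltr1n.
have hkd : `|row_mx h k| < d by rewrite (le_lt_trans _ d2) // norm_row_mx_le // ltW.
move=> /(_ hkd d0) H.
have hk : `|row_mx h k| <= `|h| + `|k| by rewrite norm_row_mx_le // ?lerDl ?lerDr.
rewrite -/k; have Ek : k - h *m - (A *m invmx B) = (h *m A + k *m B) *m invmx B.
  by rewrite mulmxDl -!mulmxA mulmxV // mulmx1 mulmxN opprK addrC.
have H1 : `|k - h *m - (A *m invmx B)| <= C * eps * (`|h| + `|k|).
  rewrite Ek (le_trans (CP _)) // -mulrA ler_pM2l // (le_trans H) // ler_pM2l //.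
have Ce : C * eps <= 2^-1.
  by rewrite mulrC -ler_pdivlMr // -invfM ge_min lexx.
have kh : `|k| <= (1 + 2 * C') * `|h|.
  have k1 : `|k| <= C' * `|h| + 2^-1 * (`|h| + `|k|).
    rewrite -{1}[k](subrK (h *m - (A *m invmx B))) addrC (le_trans (ler_normD _ _)) // lerD //.
    by rewrite (le_trans H1) // ler_wpM2r // addr_ge0.
  by move: k1; lra.
rewrite (le_trans H1) // (@le_trans _ _ (C * eps * ((2 + 2 * C') * `|h|))) //.
  by rewrite ler_pM2l ?mulr_gt0 //; lra.
rewrite mulrA ler_wpM2r // mulrAC -/K mulrC -ler_pdivlMr //.
by rewrite ge_min lexx orbT.
Qed.

End ImplicitFunction.

(** * Global sections *)

Section Convex.
Variables (R : realType) (V : normedModType R).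

Definition segment_closed (A : set V) : Prop :=
  forall x x', A x -> A x' -> forall t : R, 0 <= t <= 1 -> A (x + t *: (x' - x)).

Lemma clamp_dist (t t' : R) :
  `|Num.max 0 (Num.min 1 t') - Num.max 0 (Num.min 1 t)| <= `|t' - t|.
Proof.
have max_dist (a b : R) : `|Num.max 0 a - Num.max 0 b| <= `|a - b|.
  have h1 := ler_norm (a - b); have := ler_norm (b - a); rewrite distrC => h2.
  by rewrite ler_norml; case: (leP 0 a) => ?; case: (leP 0 b) => ?; apply/andP; split; lra.
have min_dist (a b : R) : `|Num.min 1 a - Num.min 1 b| <= `|a - b|.
  have h1 := ler_norm (a - b); have := ler_norm (b - a); rewrite distrC => h2.
  by rewrite ler_norml; case: (leP 1 a) => ?; case: (leP 1 b) => ?; apply/andP; split; lra.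
exact: le_trans (max_dist _ _) (min_dist _ _).
Qed.

(** Connectedness of a convex set: on the segment from [x0] to [x] the indicator of P would be
    continuous, with end values 1 and 0, without taking the value 1/2. *)
Lemma clopen_segment_closed (A : set V) (P : V -> Prop) : segment_closed A ->
  (forall x, A x -> P x -> exists2 d, 0 < d &
     forall x', A x' -> `|x' - x| < d -> P x') ->
  (forall x, A x -> ~ P x -> exists2 d, 0 < d &
     forall x', A x' -> `|x' - x| < d -> ~ P x') ->
  forall x0, A x0 -> P x0 -> forall x, A x -> P x.
Proof.
move=> sA Po Pc x0 Ax0 Px0 x Ax; apply: contrapT => nPx.
(* Clamping the parameter to [0, 1] keeps [gam] in A for all real [t], so that continuity can be
   proved on the whole line. *)
pose gam (t : R) := x0 + Num.max 0 (Num.min 1 t) *: (x - x0).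
have Agam t : A (gam t).
  apply: sA => //; rewrite le_max lexx /= ge_max ler01 /= ge_min lexx //.
pose f (t : R) : R := if pselect (P (gam t)) then 1 else 0.
have f0 : f 0 = 1.
  rewrite /f /gam (min_idPr _) ?ler01 // maxxx scale0r addr0.
  by case: pselect.
have f1 : f 1 = 0.
  rewrite /f /gam minxx (max_idPr _) ?ler01 // scale1r addrC subrK.
  by case: pselect.
have cf : continuous f.
  move=> t; apply/continuous_normP => e e0.
  have [d d0 dP] : exists2 d, 0 < d & forall x', A x' -> `|x' - gam t| < d -> (P x' <-> P (gam t)).
    have [Pt|nPt] := pselect (P (gam t)).
      by have [d d0 dP] := Po _ (Agam t) Pt; exists d => // x' Ax' /(dP _ Ax').
    by have [d d0 dP] := Pc _ (Agam t) nPt; exists d => // x' Ax' /(dP _ Ax').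
  exists (d / (1 + `|x - x0|)) => [|t' tt']; first by rewrite divr_gt0 // ltr_pwDl.
  have Pt : P (gam t') <-> P (gam t).
    apply: dP => //; rewrite /gam opprD addrACA subrr add0r -scalerBl normrZ.
    rewrite (@le_lt_trans _ _ (`|t' - t| * (1 + `|x - x0|))) // -?ltr_pdivlMr ?ltr_pwDl //.
    by rewrite ler_pM // ?clamp_dist // lerDr.
  rewrite /f; case: pselect => p; case: pselect => q; rewrite ?subrr ?normr0 ?(ltW e0) //.
    by case: q; apply/Pt.
  by case: p; apply/Pt.
have [||t _] := @IVT R f 0 1 2^-1 ler01.
- exact: continuous_subspaceT.
- by rewrite f0 f1 min_r ?max_l ?ler01 // invr_ge0 ler0n /= invf_le1 // ler1n.
rewrite /f; case: pselect => _ /eqP; last by rewrite eq_sym invr_eq0 pnatr_eq0.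
by rewrite eq_sym invr_eq1 -[1]/(1%:R) eqr_nat.
Qed.

End Convex.

Section Covering.
Variables (R : realType) (n m : nat) (Z : 'rV[R]_n -> set 'rV[R]_m).
Hypothesis Z_unique : forall x0 y0, Z x0 y0 ->
  exists2 d, 0 < d & forall x y y', `|x - x0| < d -> `|y - y0| < d -> `|y' - y0| < d ->
    Z x y -> Z x y' -> y = y'.
Hypothesis Z_exist : forall x0 y0 r, Z x0 y0 -> 0 < r ->
  exists2 d, 0 < d & forall x, `|x - x0| < d -> exists2 y, `|y - y0| < r & Z x y.
Hypothesis Z_closed : forall x y, ~ Z x y ->
  exists2 d, 0 < d & forall x' y', `|x' - x| < d -> `|y' - y| < d -> ~ Z x' y'.
Hypothesis Z_bounded : locally_bounded Z.

Definition continuous_on (A : set 'rV[R]_n) (s : 'rV[R]_n -> 'rV[R]_m) : Prop :=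
  forall x, A x -> forall e, 0 < e -> exists2 d, 0 < d &
    forall x', A x' -> `|x' - x| < d -> `|s x' - s x| < e.

Definition is_section (A : set 'rV[R]_n) (s : 'rV[R]_n -> 'rV[R]_m) : Prop :=
  (forall x, A x -> Z x (s x)) /\ continuous_on A s.

(** Triviality of the covering over A. Only existence is required: uniqueness comes from
    [section_unique] when A is convex. *)
Definition trivial_on (A : set 'rV[R]_n) : Prop :=
  forall x0 p, A x0 -> Z x0 p -> exists2 s, s x0 = p & is_section A s.

Lemma is_section_sub A B s : A `<=` B -> is_section B s -> is_section A s.
Proof.
move=> AB [Zs cs]; split=> [x /AB/Zs//|x /AB/cs c e /c[d d0 dP]].
by exists d => // x' /AB/dP.
Qed.

Lemma trivial_on_sub A B : A `<=` B -> trivial_on B -> trivial_on A.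
Proof.
move=> AB tB x0 p /AB Bx0 Zp; have [s sx0 sB] := tB _ _ Bx0 Zp.
by exists s => //; exact: is_section_sub sB.
Qed.

(** The coincidence set is open by local uniqueness of the zeros, and its complement is open by
    continuity. *)
Lemma section_unique A s s' x0 : segment_closed A -> is_section A s -> is_section A s' ->
  A x0 -> s x0 = s' x0 -> forall x, A x -> s x = s' x.
Proof.
move=> sA [Zs cs] [Zs' cs'] Ax0 s0.
apply: (clopen_segment_closed sA (P := fun x => s x = s' x)) Ax0 s0 => x Ax ss'.
  have [d d0 dP] := Z_unique (Zs x Ax).
  have [d1 d10 d1P] := cs x Ax d d0; have [d2 d20 d2P] := cs' x Ax d d0.
  exists (Num.min d (Num.min d1 d2)) => [|x' Ax']; first by rewrite !lt_min d0 d10.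
  rewrite !lt_min => /and3P[xd /d1P-/(_ Ax') sd /d2P-/(_ Ax') s'd].
  by apply: (dP x') => //; [rewrite ss' | apply: Zs | apply: Zs'].
pose e := `|s x - s' x| / 2; have e0 : 0 < e.
  by rewrite divr_gt0 // normr_gt0 subr_eq0; apply/eqP.
have [d1 d10 d1P] := cs x Ax e e0; have [d2 d20 d2P] := cs' x Ax e e0.
exists (Num.min d1 d2) => [|x' Ax']; first by rewrite !lt_min d10.
rewrite !lt_min => /andP[/d1P-/(_ Ax') sd /d2P-/(_ Ax') s'd] E.
have : `|s x - s' x| < e + e.
  rewrite -[s x - s' x](subrKA (s x')) (le_lt_trans (ler_normD _ _)) //.
  by rewrite distrC ltrD // E.
by rewrite /e -splitr ltxx.
Qed.

(** A section over one piece is continued over the other from its value at [z]. The two agree on the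
    convex intersection, and closedness of the pieces makes the pasted map continuous. *)
Lemma trivial_glue A1 A2 z : segment_closed A1 -> segment_closed A2 ->
  (forall x, ~ A1 x -> exists2 d, 0 < d & forall x', `|x' - x| < d -> ~ A1 x') ->
  (forall x, ~ A2 x -> exists2 d, 0 < d & forall x', `|x' - x| < d -> ~ A2 x') ->
  A1 z -> A2 z -> trivial_on A1 -> trivial_on A2 -> trivial_on (A1 `|` A2).
Proof.
move=> + + + + + + + + x0 p; have glue B1 B2 : segment_closed B1 -> segment_closed B2 ->
    (forall x, ~ B1 x -> exists2 d, 0 < d & forall x', `|x' - x| < d -> ~ B1 x') ->
    (forall x, ~ B2 x -> exists2 d, 0 < d & forall x', `|x' - x| < d -> ~ B2 x') ->
    B1 z -> B2 z -> trivial_on B1 -> trivial_on B2 -> B1 x0 -> Z x0 p ->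
    exists2 s, s x0 = p & is_section (B1 `|` B2) s.
  move=> sB1 sB2 cB1 cB2 B1z B2z t1 t2 B1x0 Zp.
  have [s1 s1p sec1] := t1 _ _ B1x0 Zp.
  have [s2 s2z sec2] := t2 _ _ B2z (sec1.1 z B1z).
  have E x : B1 x -> B2 x -> s1 x = s2 x.
    move=> B1x B2x; apply: (@section_unique (B1 `&` B2) s1 s2 z) => //.
    - move=> a b [a1 a2] [b1 b2] t t01; split; [exact: sB1 | exact: sB2].
    - by apply: is_section_sub sec1 => ? [].
    - by apply: is_section_sub sec2 => ? [].
  pose s x := if pselect (B1 x) then s1 x else s2 x.
  have sE1 x : B1 x -> s x = s1 x by rewrite /s; case: pselect.
  have sE2 x : B2 x -> s x = s2 x.
    by rewrite /s; case: pselect => // B1x B2x; apply: E.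
  exists s; first by rewrite sE1.
  split=> [x [B1x|B2x]|x Bx e e0].
  - by rewrite sE1 //; apply: sec1.1.
  - by rewrite sE2 //; apply: sec2.1.
  (* Either [x] lies in B and [s'] is continuous there, or a neighbourhood of [x] misses B. *)
  have loc B s' (sec : is_section B s') :
      (forall x, ~ B x -> exists2 d, 0 < d & forall x', `|x' - x| < d -> ~ B x') ->
      (forall x, B x -> s x = s' x) ->
      exists2 d, 0 < d & forall x', B x' -> `|x' - x| < d -> `|s x' - s x| < e.
    move=> cB sE; have [Bx'|nBx] := pselect (B x).
      have [d d0 dP] := sec.2 x Bx' e e0; exists d => // x' B' xd.
      by rewrite !sE //; apply: dP.
    by have [d d0 dP] := cB x nBx; exists d => // x' B' /dP.
  have [d1 d10 d1P] := loc _ _ sec1 cB1 sE1; have [d2 d20 d2P] := loc _ _ sec2 cB2 sE2.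
  exists (Num.min d1 d2) => [|x']; first by rewrite lt_min d10.
  by rewrite lt_min => -[B1x'|B2x'] /andP[xd1 xd2]; [apply: d1P | apply: d2P].
move=> sA1 sA2 cA1 cA2 A1z A2z t1 t2 [A1x0|A2x0] Zp; first exact: glue.
by rewrite setUC; apply: glue.
Qed.

(* When [y] is not in [Z x0], the conclusion holds vacuously near [(x0, y)]; this
   uniform statement is what the compactness argument of [trivial_nbhs] needs. *)
Lemma local_sections_at x0 y : exists2 d, 0 < d &
  forall x1 p, `|x1 - x0| < d -> `|p - y| < d -> Z x1 p ->
    exists2 s, s x1 = p & is_section [set x | `|x - x0| < d] s.
Proof.
have [Zy|/Z_closed[d d0 dP]] := pselect (Z x0 y); last first.
  by exists d => // x1 p x1d pd Zp; case: (dP x1 p).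
have [d1 d10 d1P] := Z_unique Zy; have [d2 d20 d2P] := Z_exist Zy d10.
pose d := Num.min d1 d2; have d0 : 0 < d by rewrite lt_min d10.
exists d => // x1 p x1d pd Zp.
pose s x := xget 0 [set z | `|z - y| < d1 /\ Z x z].
have sP x z : `|x - x0| < d -> `|z - y| < d1 -> Z x z -> s x = z.
  rewrite lt_min => /andP[xd1 xd2] zy Zz; rewrite /s; case: xgetP => [w -> [wy Zw]|/(_ z)[]//].
  exact: d1P xd1 wy zy Zw Zz.
have sZ x : `|x - x0| < d -> `|s x - y| < d1 /\ Z x (s x).
  move=> xd; have /d2P[z zy Zz] : `|x - x0| < d2 by move: xd; rewrite lt_min => /andP[].
  by rewrite (sP x z).
exists s; first by apply: sP => //; move: pd; rewrite lt_min => /andP[].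
split=> [x /sZ[]//|x /= xd e e0]; have [sy Zs] := sZ x xd.
(* The second bound keeps the new zero within [d1] of [y], where it must be the value of [s]. *)
have [|d3 d30 d3P] := Z_exist Zs (r := Num.min e (d1 - `|s x - y|)).
  by rewrite lt_min e0 subr_gt0.
exists d3 => // x' /= xd' /d3P[z]; rewrite lt_min => /andP[ze zd] Zz.
rewrite (sP x' z) //; rewrite -[z](subrK (s x)) -addrA (le_lt_trans (ler_normD _ _)) //.
by move: zd; rewrite ltrBrDr.
Qed.

(** All fibres near [x0] lie in one compact ball, over which the radii of [local_sections_at] can be
    chosen uniformly. *)
Lemma trivial_nbhs x0 : exists2 d, 0 < d & trivial_on [set x | `|x - x0| < d].
Proof.
have [U U0 [C [_ CP]]] := Z_bounded x0.
(* [bounded_set] provides bounds strictly above C, hence the + 1. *)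
pose K := [set z : 'rV[R]_m | `|z - 0| <= `|C| + 1].
pose P (d : R) (y : 'rV[R]_m) := forall x1, `|x1 - x0| < d -> Z x1 y ->
  exists2 s, s x1 = y & is_section [set x | `|x - x0| < d] s.
have /compact_near_coveringP near_cover := @compact_norm_ball R m 0 (`|C| + 1).
have : \forall d \near 0^'+, K `<=` P d.
  apply: near_cover => y _; have [d d0 dP] := local_sections_at x0 y.
  exists (ball y d, [set d' : R | 0 < d' < d]) => /=.
    split; first exact: nbhsx_ballx.
    by near=> d'; apply/andP; split; near: d'; [exact: nbhs_right_gt | exact: nbhs_right_lt].
  move=> [y' d'] /= [yy' /andP[d'0 d'd]] x1 x1d Zy'.
  have [|||s sx1 sec] := dP x1 y' => //.
  - exact: lt_trans d'd.
  - by move: yy'; rewrite -ball_normE /ball_ /= distrC.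
  by exists s => //; apply: is_section_sub sec => x /= /lt_trans; apply.
move=> H; have [d' d'0 d'U] := (nbhs_normP x0 U).1 U0.
have [d [/andP[d0 dd'] dK]] : exists d : R, 0 < d < d' /\ K `<=` P d.
  have : \forall d \near 0^'+, 0 < d < d' /\ K `<=` P d.
    near=> d; split; last by near: d.
    by apply/andP; split; near: d; [exact: nbhs_right_gt | exact: nbhs_right_lt].
  by move=> /filter_ex.
exists d => // x1 p /= x1d Zp; apply: dK => //.
rewrite /K /= subr0; apply: (CP (`|C| + 1)).
  by rewrite (le_lt_trans (ler_norm _)) // ltrDl.
by exists x1 => //; apply: d'U; exact: lt_trans dd'.
Unshelve. all: by end_near. Qed.

(** * Triviality over boxes by bisection *)

Definition box (a b : 'rV[R]_n) : set 'rV[R]_n := [set x | forall i, a 0 i <= x 0 i <= b 0 i].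

Definition set_coord (a : 'rV[R]_n) (i : 'I_n) (c : R) : 'rV[R]_n :=
  \row_k (if k == i then c else a 0 k).

Lemma segment_closed_box a b : segment_closed (box a b).
Proof.
move=> x x' bx bx' t /andP[t0 t1] i; rewrite !mxE.
move: (bx i) (bx' i) => /andP[h1 h2] /andP[h3 h4]; apply/andP; split; nra.
Qed.

Lemma closed_box a b x : ~ box a b x ->
  exists2 d, 0 < d & forall x', `|x' - x| < d -> ~ box a b x'.
Proof.
move=> /existsNP[i /negP]; rewrite negb_and -!ltNge => nb.
have close (x' : 'rV[R]_n) : `|x' 0 i - x 0 i| <= `|x' - x|.
  by have := norm_entry_le (x' - x) i; rewrite !mxE.
case/orP: nb => xi; [exists (a 0 i - x 0 i) | exists (x 0 i - b 0 i)]; rewrite ?subr_gt0 //.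
  move=> x' xd /(_ i)/andP[ax' _]; have := le_lt_trans (close x') xd.
  by rewrite ltr_norml => /andP[]; lra.
move=> x' xd /(_ i)/andP[_ bx']; have := le_lt_trans (close x') xd.
by rewrite ltr_norml => /andP[]; lra.
Qed.

Lemma trivial_box_half (a b : 'rV[R]_n) i : (forall k, a 0 k <= b 0 k) ->
  let c := (a 0 i + b 0 i) / 2 in
  trivial_on (box a (set_coord b i c)) -> trivial_on (box (set_coord a i c) b) ->
  trivial_on (box a b).
Proof.
move=> ab c t1 t2; have [ac cb] : a 0 i <= c /\ c <= b 0 i.
  by have := ab i; rewrite /c; split; lra.
apply: (@trivial_on_sub _ (box a (set_coord b i c) `|` box (set_coord a i c) b)).
  move=> x bx; have [xc|cx] := leP (x 0 i) c; [left|right] => k; rewrite mxE.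
    by have /andP[h1 h2] := bx k; case: (k =P i) => ki; rewrite h1 ?h2 ?ki.
  by have /andP[h1 h2] := bx k; case: (k =P i) => ki; rewrite h2 ?h1 ?ki ?ltW.
(* The gluing point is a corner of the face common to both halves. *)
apply: (@trivial_glue _ _ (set_coord a i c)) => //;
  try exact: segment_closed_box; try exact: closed_box.
- by move=> k; rewrite !mxE; case: eqP => [->|_]; rewrite ?ac ?lexx ?ab.
- by move=> k; rewrite !mxE; case: eqP => [->|_]; rewrite ?cb ?lexx ?ab.
Qed.

Lemma nontrivial_box_halve (a b : 'rV[R]_n) : (forall k, a 0 k <= b 0 k) -> ~ trivial_on (box a b) ->
  exists a' b', ~ trivial_on (box a' b') /\
    forall k, [/\ a 0 k <= a' 0 k, b' 0 k <= b 0 k & b' 0 k - a' 0 k = (b 0 k - a 0 k) / 2].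
Proof.
(* The coordinates are halved one at a time; [j] counts those already treated. *)
move=> ab nt; suff H j : (j <= n)%N -> exists a' b', ~ trivial_on (box a' b') /\
    forall k : 'I_n, [/\ a 0 k <= a' 0 k, b' 0 k <= b 0 k &
      b' 0 k - a' 0 k = if (k < j)%N then (b 0 k - a 0 k) / 2 else b 0 k - a 0 k].
  have [a' [b' [nt' H']]] := H n (leqnn n); exists a', b'; split=> // k.
  by have := H' k; rewrite ltn_ord.
elim: j => [_|j IHj jn]; first by exists a, b; split=> // k; split.
have [a' [b' [nt' H']]] := IHj (ltnW jn).
pose i := Ordinal jn; pose c := (a' 0 i + b' 0 i) / 2.
have ab' k : a' 0 k <= b' 0 k.
  have [_ _] := H' k; have := ab k; case: ifP => _; lra.
have [t1|nt1] := pselect (trivial_on (box a' (set_coord b' i c))).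
  have nt2 : ~ trivial_on (box (set_coord a' i c) b').
    by move=> t2; apply: nt'; exact: trivial_box_half t1 t2.
  exists (set_coord a' i c), b'; split=> // k; have [h1 h2 h3] := H' k.
  rewrite ltnS leq_eqVlt !mxE -val_eqE /=; case: eqP => [kj|_] /=; last by split.
  move: h1 h2 h3 (ab' i); have -> : k = i by apply: val_inj.
  by rewrite ltnn /c; split; lra.
exists a', (set_coord b' i c); split=> // k; have [h1 h2 h3] := H' k.
rewrite ltnS leq_eqVlt !mxE -val_eqE /=; case: eqP => [kj|_] /=; last by split.
move: h1 h2 h3 (ab' i); have -> : k = i by apply: val_inj.
by rewrite ltnn /c; split; lra.
Qed.

(** Repeated halving of a non-trivial box gives nested non-trivial boxes shrinking to a point [x];
    one of them lies in the neighbourhood of [x] given by [trivial_nbhs]. *)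
Lemma trivial_box (a b : 'rV[R]_n) : (forall k, a 0 k <= b 0 k) -> trivial_on (box a b).
Proof.
move=> ab; apply: contrapT => nt.
pose good (u : 'rV[R]_n * 'rV[R]_n) := (forall k, u.1 0 k <= u.2 0 k) /\ ~ trivial_on (box u.1 u.2).
have /choice[f fP] : forall u, exists u' : 'rV[R]_n * 'rV[R]_n, good u -> good u' /\
    forall k, [/\ u.1 0 k <= u'.1 0 k, u'.2 0 k <= u.2 0 k & u'.2 0 k - u'.1 0 k = (u.2 0 k - u.1 0 k) / 2].
  move=> u; have [[uab unt]|ng] := pselect (good u); last by exists u => /ng.
  have [a' [b' [nt' H]]] := nontrivial_box_halve uab unt; exists (a', b') => _.
  split=> //; split=> //= k; have [_ _] := H k; have := uab k; lra.
pose u k := iter k f (a, b).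
have ug k : good (u k) by elim: k => [|k /fP[]].
have us k i := (fP _ (ug k)).2 i.
have wid k i : (u k).2 0 i - (u k).1 0 i = (b 0 i - a 0 i) / 2 ^+ k.
  elim: k => [|k IHk]; first by rewrite divr1.
  by have [_ _] := us k i; rewrite -/(u k.+1) IHk => ->; rewrite exprSr invfM mulrA.
have inc k l i : (u k).1 0 i <= (u (k + l)%N).1 0 i.
  elim: l => [|l IHl]; first by rewrite addn0.
  by rewrite addnS (le_trans IHl) //; have [] := us (k + l)%N i.
have dec k l i : (u (k + l)%N).2 0 i <= (u k).2 0 i.
  elim: l => [|l IHl]; first by rewrite addn0.
  by rewrite addnS (le_trans _ IHl) //; have [] := us (k + l)%N i.
have cross k l i : (u k).1 0 i <= (u l).2 0 i.
  rewrite (le_trans (inc k l i)) // (le_trans ((ug _).1 i)) //.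
  by rewrite addnC dec.
pose E i := [set (u k).1 0 i | k in [set: nat]].
pose x : 'rV[R]_n := \row_i sup (E i).
have ubE i l : ubound (E i) ((u l).2 0 i) by move=> _ [k _ <-].
have xb k : box (u k).1 (u k).2 x.
  move=> i; rewrite mxE; apply/andP; split.
    by apply: ub_le_sup; [exists ((u k).2 0 i) | exists k].
  by apply: ge_sup; [exists ((u 0%N).1 0 i); exists 0%N | ].
have [d d0 dP] := trivial_nbhs x.
have [k kP] : exists k, `|b - a| / 2 ^+ k < d.
  exists (Num.truncn (`|b - a| / d)).+1; rewrite ltr_pdivrMr ?exprn_gt0 // -ltr_pdivrMl // mulrC.
  rewrite (lt_le_trans (truncnS_gt _)) // -natrX ler_nat ltnW //.
  exact: ltn_expl.
apply: (ug k).2; apply: trivial_on_sub dP => z bz /=.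
apply: le_lt_trans kP; apply: norm_row_le => [|i]; first by rewrite divr_ge0 // exprn_ge0.
have w : (u k).2 0 i - (u k).1 0 i <= `|b - a| / 2 ^+ k.
  rewrite wid ler_pM2r ?invr_gt0 ?exprn_gt0 // (le_trans (ler_norm _)) //.
  by have := norm_entry_le (b - a) i; rewrite !mxE.
move: (bz i) (xb k i) w => /andP[h1 h2] /andP[h3 h4] w.
rewrite [(z - x) 0 i]mxE [(- x) 0 i]mxE ler_norml; apply/andP; split; lra.
Qed.

(** In the sup norm, balls are boxes. The sections over the balls of integer radius all start from
    [p] at the centre, so they extend one another. *)
Lemma global_section x0 p : Z x0 p ->
  exists s : 'rV[R]_n -> 'rV[R]_m, [/\ s x0 = p, continuous s & forall x, Z x (s x)].
Proof.
move=> Zp; pose B (N : nat) := [set x : 'rV[R]_n | `|x - x0| <= N%:R].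
have BN N : B N = box (x0 - const_mx N%:R) (x0 + const_mx N%:R).
  apply/seteqP; split=> x.
    move=> xN i; rewrite !mxE; have := le_trans (norm_entry_le (x - x0) i) xN.
    by rewrite !mxE ler_norml => /andP[h1 h2]; apply/andP; split; lra.
  move=> bx; apply: norm_row_le => // i; have /andP[] := bx i; rewrite !mxE => h1 h2.
  by rewrite ler_norml; apply/andP; split; lra.
have B0 N : B N x0 by rewrite /B /= subrr normr0.
have /choice[s sP] : forall N, exists s, s x0 = p /\ is_section (B N) s.
  move=> N; have tB : trivial_on (B N).
    rewrite BN; apply: trivial_box => k; rewrite !mxE.
    by have := ler0n R N; lra.
  by have [s] := tB _ _ (B0 N) Zp; exists s.
have sE N N' x : (N <= N')%N -> B N x -> s N x = s N' x.
  move=> NN' Bx; apply: (@section_unique (B N) (s N) (s N') x0) => //.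
  - by rewrite BN; exact: segment_closed_box.
  - exact: (sP N).2.
  - apply: is_section_sub (sP N').2 => z /le_trans; apply; by rewrite ler_nat.
  - by rewrite !(sP _).1.
pose N x := (Num.truncn (`|x - x0|)).+1.
have NB x : B (N x) x by rewrite /B /= ltW // truncnS_gt.
exists (fun x => s (N x) x); split=> [|x|x]; first exact: (sP _).1.
- apply/continuous_normP => e e0.
  (* The next larger ball contains every point at distance at most 1 from [x], so a single section
     describes the map near [x]. *)
  have BNx : B (N x).+1 x by rewrite /B /= (le_trans (NB x)) // ler_nat.
  have [d d0 dP] := (sP (N x).+1).2.2 x BNx e e0.
  exists (Num.min 1 d) => [|x']; first by rewrite lt_min ltr01.
  rewrite lt_min => /andP[x1 xd].
  have Bx' : B (N x).+1 x'.
    rewrite /B /= -[x' - x0](subrKA x) (le_trans (ler_normD _ _)) // -natr1 addrC.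
    by rewrite lerD //; [exact: NB | exact: ltW].
  rewrite (sE (N x) (N x).+1 x) //.
  have -> : s (N x') x' = s (N x).+1 x'.
    have [h|/ltnW h] := leqP (N x') (N x).+1; [exact: sE | exact/esym/sE].
  exact/ltW/dP.
- exact: (sP _).2.1.
Qed.

Lemma global_section_unique (s s' : 'rV[R]_n -> 'rV[R]_m) x0 : continuous s -> continuous s' ->
  (forall x, Z x (s x)) -> (forall x, Z x (s' x)) -> s x0 = s' x0 -> s = s'.
Proof.
move=> cs cs' Zs Zs' s0; have on t : continuous t -> continuous_on setT t.
  move=> ct x _ e e0; have [|d d0 dP] := (continuous_normP t x).1 (ct x) (e / 2).
    by rewrite divr_gt0.
  exists d => // x' _ /dP h; rewrite (le_lt_trans h) //; lra.
by apply/funext => x; apply: (@section_unique setT s s' x0) => //; split=> //; apply: on.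
Qed.

(** A bounded fibre is covered by finitely many balls, each containing no point of the fibre other
    than possibly its centre. *)
Lemma finite_fibre x : finite_set (Z x).
Proof.
have [U U0 [C [_ CP]]] := Z_bounded x.
have /choice[d dP] : forall y, exists d, 0 < d /\ forall z, `|z - y| < d -> Z x z -> z = y.
  move=> y; have [Zy|/Z_closed[d d0 dP]] := pselect (Z x y).
    have [d d0 dP] := Z_unique Zy; exists d; split=> // z zd Zz.
    by apply: (dP x) => //; rewrite subrr normr0.
  by exists d; split=> // z zd Zz; case: (dP x z) => //; rewrite subrr normr0.
have := @compact_norm_ball R m 0 (`|C| + 1); rewrite compact_cover.
move=> /(_ _ [set: 'rV[R]_m] (fun y => ball y (d y)))[|y _|D _ DP].
- by move=> y _; apply: ball_open; have [] := dP y.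
- by exists y => //; apply: ballxx; have [] := dP y.
apply: sub_finite_set (finite_fset D) => y Zy.
have [|z zD] := DP y.
  rewrite /= subr0; apply: (CP (`|C| + 1)).
    by rewrite (le_lt_trans (ler_norm _)) // ltrDl.
  by exists x => //; exact: nbhs_singleton.
by rewrite -ball_normE /ball_ /= distrC => /(dP z).2-/(_ Zy)->.
Qed.

End Covering.

(** * Functions of class C^k *)

Section ClassC.
Variables (R : realType) (V : normedModType R).

Lemma class_C_ext (W : normedModType R) k (f g : V -> W) :
  (forall x, g x = f x) -> class_C k f -> class_C k g.
Proof. by move=> /funext ->. Qed.

Lemma class_CW (W : normedModType R) k (f : V -> W) : class_C k.+1 f -> class_C k f.
Proof.
elim: k f => [|k IHk] f [df cf]; first by move=> x; apply: differentiable_continuous.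
by split=> // v; apply: IHk.
Qed.

Lemma class_C_le (W : normedModType R) j k (f : V -> W) : (j <= k)%N -> class_C k f -> class_C j f.
Proof.
move=> /subnKC <-; elim: (k - j)%N => [|l IHl]; first by rewrite addn0.
by rewrite addnS => /class_CW.
Qed.

Lemma class_C_cst (W : normedModType R) k (c : W) : class_C k (fun _ : V => c).
Proof.
elim: k c => [|k IHk] c; first by move=> x; exact: cvg_cst.
split=> [x|v]; first exact: differentiable_cst.
by apply: (@class_C_ext _ _ (fun=> 0)) => // x; exact: derive_cst.
Qed.

Lemma class_CD (W : normedModType R) k (f g : V -> W) :
  class_C k f -> class_C k g -> class_C k (fun x => f x + g x).
Proof.
elim: k f g => [|k IHk] f g; first by move=> cf cg x; apply: cvgD; [exact: cf | exact: cg].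
move=> [df cf] [dg cg]; split=> [x|v]; first exact: differentiableD.
apply: (@class_C_ext _ _ (fun x => 'D_v f x + 'D_v g x)); last by apply: IHk; [exact: cf | exact: cg].
by move=> x; apply: deriveD; apply: diff_derivable.
Qed.

Lemma class_C_sum (W : normedModType R) k (I : Type) (s : seq I) (f : I -> V -> W) :
  (forall i, class_C k (f i)) -> class_C k (fun x => \sum_(i <- s) f i x).
Proof.
move=> cf; elim: s => [|i s IHs].
  by under eq_fun do rewrite big_nil; apply: class_C_cst.
by under eq_fun do rewrite big_cons; apply: class_CD.
Qed.

Lemma class_CM k (f g : V -> R) :
  class_C k f -> class_C k g -> class_C k (fun x => f x * g x).
Proof.
elim: k f g => [|k IHk] f g.
  by move=> cf cg x; apply: (@continuousM R V f g); [exact: cf | exact: cg].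
move=> cf cg; have [[df cf'] [dg cg']] := (cf, cg); split=> [x|v]; first exact: differentiableM.
apply: (@class_C_ext _ _ (fun x => f x * 'D_v g x + g x * 'D_v f x)).
  by move=> x; apply: deriveM; apply: diff_derivable.
by apply: class_CD; apply: IHk; do [exact: cf' | exact: cg' | exact: class_CW].
Qed.

Lemma class_C_prod k (I : Type) (s : seq I) (f : I -> V -> R) :
  (forall i, class_C k (f i)) -> class_C k (fun x => \prod_(i <- s) f i x).
Proof.
move=> cf; elim: s => [|i s IHs].
  by under eq_fun do rewrite big_nil; apply: class_C_cst.
by under eq_fun do rewrite big_cons; apply: class_CM.
Qed.

Lemma class_CN k (f : V -> R) : class_C k f -> class_C k (fun x => - f x).
Proof.
move=> cf; apply: (@class_C_ext _ _ (fun x => -1 * f x)) => [x|]; first by rewrite mulN1r.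
by apply: class_CM => //; apply: class_C_cst.
Qed.

Lemma class_CV k (f : V -> R) : (forall x, f x != 0) ->
  class_C k f -> class_C k (fun x => (f x)^-1).
Proof.
move=> f0; elim: k => [|k IHk] cf.
  by move=> x; apply: cvgV; [exact: f0 | exact: cf].
have [df cf'] := cf; split=> [x|v]; first exact: differentiableV.
have cfV := IHk (class_CW cf).
apply: (@class_C_ext _ _ (fun x => - ((f x)^-1 * (f x)^-1 * 'D_v f x))) => [x|].
  rewrite deriveV //; last exact: diff_derivable.
  by rewrite [LHS]mulNr expr2 invfM.
by apply: class_CN; apply: class_CM; [exact: class_CM | exact: cf'].
Qed.

Lemma differentiable_rowP q (f : V -> 'rV[R]_q) x :
  (forall j, differentiable (fun x => f x 0 j) x) -> differentiable f x.
Proof.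
move=> df; have -> : f = \sum_(j < q) (fun x => f x 0 j *: delta_mx 0 j).
  apply/funext => z; rewrite {1}(row_sum_delta (f z)).
  by rewrite (big_morph (fun g : V -> 'rV[R]_q => g z) (id1 := 0) (op1 := +%R)).
by apply: differentiable_sum => j; apply: differentiableZl.
Qed.

Lemma differentiable_entry q (f : V -> 'rV[R]_q) x j :
  differentiable f x -> differentiable (fun x => f x 0 j) x.
Proof.
by move=> df; apply: (differentiable_comp (g := fun v : 'rV[R]_q => v 0 j)) => //;
  apply: differentiable_coord.
Qed.

Lemma derive_entry q (f : V -> 'rV[R]_q) x v j :
  differentiable f x -> 'D_v f x 0 j = 'D_v (fun x => f x 0 j) x.
Proof. by move=> df; rewrite derive_mx ?mxE //; apply: diff_derivable. Qed.

Lemma class_C_rowP q k (f : V -> 'rV[R]_q) :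
  class_C k f <-> forall j, class_C k (fun x => f x 0 j).
Proof.
elim: k f => [|k IHk] f.
  split=> [cf j x|cf x]; first exact: (continuous_rowP f x).1 (cf x) j.
  by apply/continuous_rowP => j; exact: cf.
split=> [[df cf] j|cf].
  split=> [x|v]; first exact: differentiable_entry.
  apply: (@class_C_ext _ _ (fun x => 'D_v f x 0 j)) => [x|]; first by rewrite derive_entry.
  exact: (IHk _).1 (cf v) j.
have df x : differentiable f x by apply: differentiable_rowP => j; exact: (cf j).1 x.
split=> // v; apply/IHk => j.
apply: (@class_C_ext _ _ (fun x => 'D_v (fun x => f x 0 j) x)) => [x|]; last exact: (cf j).2 v.
by rewrite derive_entry.
Qed.

(** The chain rule in coordinates expresses the derivative by sums and products of compositions, to
    which the induction hypothesis applies. *)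
Lemma class_C_comp p k (f : 'rV[R]_p -> R) (h : V -> 'rV[R]_p) :
  class_C k f -> class_C k h -> class_C k (fun x => f (h x)).
Proof.
elim: k f => [|k IHk] f.
  by move=> cf ch x; apply: continuous_comp; [exact: ch | exact: cf].
move=> [df cf] ch; have [dh ch'] := ch; split=> [x|v].
  by apply: (differentiable_comp (g := f)) => //.
apply: (@class_C_ext _ _ (fun x => \sum_i 'D_v h x 0 i * 'D_(delta_mx 0 i) f (h x))); last first.
  apply: class_C_sum => i; apply: class_CM; first exact: (class_C_rowP k ('D_v h)).1 (ch' v) i.
  by apply: (IHk ('D_(delta_mx 0 i) f)); [exact: cf | exact: class_CW].
move=> x; rewrite -derive_row_sum // !deriveE //; last first.
  exact: (differentiable_comp (g := f)).
by rewrite (diff_comp (g := f)).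
Qed.

Lemma class_C_det k m (A : V -> 'M[R]_m) :
  (forall i j, class_C k (fun x => A x i j)) -> class_C k (fun x => \det (A x)).
Proof.
move=> cA; rewrite /determinant; apply: class_C_sum => s; apply: class_CM; first exact: class_C_cst.
by apply: class_C_prod => i; apply: cA.
Qed.

(** By Cramer's formula, the inverse is rational in the entries. *)
Lemma class_C_invmx k m (A : V -> 'M[R]_m) : (forall x, A x \in unitmx) ->
  (forall i j, class_C k (fun x => A x i j)) ->
  forall i j, class_C k (fun x => invmx (A x) i j).
Proof.
move=> Au cA i j; under eq_fun do rewrite /invmx Au !mxE.
apply: class_CM.
  apply: class_CV; last exact: class_C_det.
  by move=> x; rewrite -unitfE -unitmxE.
rewrite /cofactor; apply: class_CM; first exact: class_C_cst.
apply: class_C_det => k' l; under eq_fun do rewrite !mxE; exact: cA.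
Qed.

End ClassC.

Lemma class_C_coord (R : realType) p k (i : 'I_p) : class_C k (fun x : 'rV[R]_p => x 0 i).
Proof.
case: k => [|k]; first exact: coord_continuous.
have E v (x : 'rV[R]_p) : 'D_v (fun x : 'rV[R]_p => x 0 i) x = v 0 i.
  by rewrite -derive_entry // derive_id.
split=> [x|v]; first exact: differentiable_coord.
by under eq_fun do rewrite E; exact: class_C_cst.
Qed.

Lemma class_C_row_mx (R : realType) n m k (s : 'rV[R]_n -> 'rV[R]_m) :
  class_C k s -> class_C k (fun x => row_mx x (s x)).
Proof.
move=> cs; apply/class_C_rowP => i; under eq_fun do rewrite mxE.
case: (fintype.split i) => j; first exact: class_C_coord.
by move: j; apply/class_C_rowP.
Qed.

Section Bootstrap.
Variables (R : realType) (n m K : nat) (F : 'rV[R]_(n + m) -> 'rV[R]_m).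
Hypothesis F_CK : forall j, class_C K.+1 (fun w => F w 0 j).
Hypothesis F_regular : forall x y, zeros F x y -> dsubmx (jac F (row_mx x y)) \in unitmx.

(** The formula for the derivative of [s] involves [s] only through the Jacobian of F, of class C^K.
    Hence class C^k of [s] gives class C^k of its derivative, as long as k <= K. *)
Lemma section_class_C (s : 'rV[R]_n -> 'rV[R]_m) :
  continuous s -> (forall x, zeros F x (s x)) -> class_C K.+1 s.
Proof.
move=> cs zs.
have dF j w : differentiable (fun w => F w 0 j) w by exact: (F_CK j).1.
have CF j u : continuous (fun w => 'D_u (fun w => F w 0 j) w).
  by have := (F_CK j).2 u; apply: (@class_C_le _ _ _ 0 K).
have ds := section_differentiable dF CF F_regular cs zs.
suff H k : (k <= K.+1)%N -> class_C k s by exact: H.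
elim: k => [//|k IHk] kK; split=> [x|v]; first by have [] := ds x.
have {}IHk := IHk (ltnW kK).
under eq_fun do rewrite (ds _).2.
have cgr := class_C_row_mx IHk.
have cJ i j : class_C k (fun x => jac F (row_mx x (s x)) i j).
  under eq_fun do rewrite mxE; apply: (@class_C_comp _ _ _ _ ('D_(delta_mx 0 i) (fun w => F w 0 j)) _ _ cgr).
  by apply: (@class_C_le _ _ _ k K); [rewrite -ltnS | exact: (F_CK j).2].
apply/class_C_rowP => j; under eq_fun do rewrite mxE.
apply: class_C_sum => i; apply: class_CM; first exact: class_C_cst.
under eq_fun do rewrite mxE mxE; apply: class_CN; apply: class_C_sum => l.
apply: class_CM; first by under eq_fun do rewrite mxE; exact: cJ.
apply: class_C_invmx => [x|a b]; first exact: F_regular.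
by under eq_fun do rewrite mxE; exact: cJ.
Qed.

End Bootstrap.

(** * Local minimizers *)

Section Bilinear.
Variables (R : realType) (m : nat).
Implicit Types (u v w : 'rV[R]_m) (H : 'M[R]_m).

Definition bil H u v : R := \sum_j (u *m H) 0 j * v 0 j.

Definition psd H : Prop := forall v, 0 <= bil H v v.

Lemma dot_bound u v : `|\sum_j u 0 j * v 0 j| <= m%:R * (`|u| * `|v|).
Proof.
rewrite (le_trans (ler_norm_sum _ _ _)) //.
rewrite (@le_trans _ _ (\sum_(j < m) `|u| * `|v|)) //.
  by apply: ler_sum => j _; rewrite normrM ler_pM // norm_entry_le.
by rewrite sumr_const card_ord mulr_natl.
Qed.

Lemma bilDl H u v w : bil H (u + v) w = bil H u w + bil H v w.
Proof. by rewrite /bil -big_split; apply: eq_bigr => j _; rewrite mulmxDl mxE mulrDl. Qed.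

Lemma bilDr H u v w : bil H u (v + w) = bil H u v + bil H u w.
Proof. by rewrite /bil -big_split; apply: eq_bigr => j _; rewrite [(v + w) 0 j]mxE mulrDr. Qed.

Lemma bilZl H a u v : bil H (a *: u) v = a * bil H u v.
Proof. by rewrite /bil mulr_sumr; apply: eq_bigr => j _; rewrite -scalemxAl mxE mulrA. Qed.

Lemma bilZr H a u v : bil H u (a *: v) = a * bil H u v.
Proof. by rewrite /bil mulr_sumr; apply: eq_bigr => j _; rewrite [(a *: v) 0 j]mxE mulrCA. Qed.

Lemma bil_sym H u v : H^T = H -> bil H u v = bil H v u.
Proof.
move=> sH; rewrite /bil.
under eq_bigr do rewrite mxE mulr_suml; rewrite exchange_big /=; apply: eq_bigr => i _.
rewrite mxE mulr_suml; apply: eq_bigr => j _.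
by rewrite -{1}sH mxE mulrC mulrA mulrAC.
Qed.

Lemma bil_delta H u j : bil H u (delta_mx 0 j) = (u *m H) 0 j.
Proof.
rewrite /bil (bigD1 j) //= big1 ?addr0 => [|i ij]; rewrite !mxE !eqxx ?mulr1 //.
by rewrite (negPf ij) mulr0.
Qed.

Lemma bil_perturb H H' e v : (forall i j, `|H' i j - H i j| <= e) ->
  `|bil H' v v - bil H v v| <= (m%:R * (m%:R * e)) * `|v| ^+ 2.
Proof.
move=> He; have -> : bil H' v v - bil H v v = \sum_j (v *m (H' - H)) 0 j * v 0 j.
  rewrite /bil -sumrB; apply: eq_bigr => j _.
  by rewrite mulmxBr -mulrBl; congr (_ * _); rewrite !mxE.
rewrite (le_trans (dot_bound _ _)) // -mulrA ler_wpM2l // expr2 mulrA ler_wpM2r //.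
(* For m = 0 the hypothesis does not force [e] to be nonnegative. *)
case: m H H' v He => [|k] H H' v He.
  by rewrite !mul0r (_ : _ *m _ = 0) ?normr0 //; apply/rowP => -[].
apply: norm_row_le => [|j]; first by rewrite !mulr_ge0 // (le_trans _ (He 0 0)).
rewrite mxE (le_trans (ler_norm_sum _ _ _)) //.
rewrite (@le_trans _ _ (\sum_(i < k.+1) e * `|v|)) //.
  apply: ler_sum => i _; rewrite normrM mulrC ler_pM ?norm_entry_le //.
  by have := He i j; rewrite !mxE.
by rewrite sumr_const card_ord -[leLHS]mulr_natl mulrA.
Qed.

(** A vector on which a semidefinite form vanishes lies in the kernel: nonnegativity on the line
    [v + t *: w] forces [bil H v w = 0] for each basis vector [w]. *)
Lemma psd_unit_definite H v : H^T = H -> H \in unitmx -> psd H -> bil H v v = 0 -> v = 0.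
Proof.
move=> sH uH pH v0; rewrite -[v](mulmxK uH); suff -> : v *m H = 0 by rewrite mul0mx.
apply/rowP => j; rewrite [RHS]mxE -bil_delta; set w := delta_mx 0 j.
have Q t : 0 <= 2 * t * bil H v w + t ^+ 2 * bil H w w.
  have := pH (v + t *: w); rewrite bilDl !bilDr v0 bilZr !bilZl bilZr (bil_sym w) //; lra.
have w0 := pH w; set b := bil H v w in Q *; set c := bil H w w in Q w0.
(* The minimiser of the quadratic [Q] would be [- b / c], but [c] may vanish. *)
have := Q (- b / (1 + c)); have c1 : 0 < 1 + c by rewrite ltr_pwDl.
have -> : 2 * (- b / (1 + c)) * b + (- b / (1 + c)) ^+ 2 * c =
    - (b ^+ 2 * ((2 + c) / (1 + c) ^+ 2)).
  by field; rewrite gt_eqF.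
rewrite oppr_ge0 pmulr_lle0; last by rewrite divr_gt0 ?exprn_gt0 // ltr_pwDl.
by move=> b2; apply/eqP; rewrite -sqrf_eq0 eq_le b2 sqr_ge0.
Qed.

Lemma bil_continuous H : continuous (fun v => bil H v v).
Proof.
apply: (@continuous_sum R 'rV[R]_m R) => j v.
apply: (@continuousM R 'rV[R]_m (fun v => (v *m H) 0 j) (fun v => v 0 j)).
  exact: (continuous_rowP (fun v : 'rV[R]_m => v *m H) v).1 (@continuous_mulmx _ _ _ _ v) j.
exact: coord_continuous.
Qed.

Lemma psd_coercive H : H^T = H -> H \in unitmx -> psd H ->
  exists2 c, 0 < c & forall v, c * `|v| ^+ 2 <= bil H v v.
Proof.
move=> sH uH pH; pose S := [set v : 'rV[R]_m | `|v| = 1].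
have normalize v : v != 0 -> S (`|v|^-1 *: v).
  by move=> v0; rewrite /S /= normrZ normfV normr_id mulVf ?normr_eq0.
(* When m = 0 the unit sphere is empty, and there is nothing to minimise. *)
have [S0|/set0P/negP/negPn/eqP S0] := pselect (S !=set0); last first.
  exists 1 => // v; have [->|/normalize] := eqVneq v 0; last by rewrite S0.
  by rewrite normr0 expr0n /= mulr0.
have cS : compact S.
  apply: (subclosed_compact _ (@compact_norm_ball R m 0 1)); last by move=> v; rewrite /S /= subr0 => ->.
  have -> : S = (fun v : 'rV[R]_m => `|v|) @^-1` [set 1] by [].
  apply: closed_comp; last exact: closed_eq.
  by move=> v _; exact: norm_continuous.
have [v /set_mem vS vmin] := EVT_min_rV S0 cS (continuous_subspaceT (@bil_continuous H)).
have v0 : 0 < bil H v v.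
  rewrite lt_neqAle pH andbT eq_sym; apply/eqP => /(psd_unit_definite sH uH pH) v0.
  by move: vS; rewrite /S /= v0 normr0 => /eqP; rewrite eq_sym oner_eq0.
exists (bil H v v) => // w; have [->|w0] := eqVneq w 0.
  by rewrite normr0 expr0n mulr0; exact: pH.
have := vmin _ (mem_set (normalize w w0)); rewrite bilZl bilZr mulrA -expr2 exprVn mulrC.
by rewrite ler_pdivlMr // exprn_gt0 // normr_gt0.
Qed.

End Bilinear.

Section LocalMinimizers.
Variables (R : realType) (m : nat) (phi : 'rV[R]_m -> R).
Hypothesis phi_C2 : class_C 2 phi.
Implicit Types y v : 'rV[R]_m.

Let phi_diff y : differentiable phi y.
Proof. exact: phi_C2.1. Qed.

Let grad_diff j y : differentiable (fun y => gradient phi y 0 j) y.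
Proof. by under eq_fun do rewrite mxE; exact: (phi_C2.2 (delta_mx 0 j)).1. Qed.

Let grad_C1 j u : continuous (fun y => 'D_u (fun y => gradient phi y 0 j) y).
Proof.
have -> : (fun y => gradient phi y 0 j) = partial j phi by apply/funext => y; rewrite mxE.
exact: (phi_C2.2 (delta_mx 0 j)).2 u.
Qed.

Lemma jac_gradient y : jac (gradient phi) y = hessian phi y.
Proof.
apply/matrixP => i j; rewrite [LHS]mxE [RHS]mxE /partial.
by congr ('D__ _ _); apply/funext => z; rewrite mxE.
Qed.

Lemma derive_gradient y v : 'D_v phi y = \sum_j gradient phi y 0 j * v 0 j.
Proof.
by rewrite derive_row_sum //; apply: eq_bigr => j _; rewrite mxE mulrC.
Qed.

Lemma hessian_sym y : (hessian phi y)^T = hessian phi y.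
Proof.
apply/matrixP => i j; rewrite mxE; set H := hessian phi y.
apply/eqP; rewrite -subr_eq0 -normr_le0; apply/ler_addgt0Pl => e e0; rewrite addr0.
have [|d d0 dP] := strict_differentiability grad_diff grad_C1 y (e := e / 2).
  by rewrite divr_gt0.
rewrite jac_gradient -/H in dP.
pose t := d / 3; have t0 : 0 < t by rewrite divr_gt0.
pose E (i : 'I_m) : 'rV[R]_m := t *: delta_mx 0 i.
have Et k : `|E k| <= t.
  apply: norm_row_le => [|l]; first exact: ltW.
  rewrite !mxE eqxx /=; case: eqP => _; rewrite ?mulr1 ?mulr0 ?normr0 ?(ltW t0) //.
  by rewrite gtr0_norm.
(* The second difference [D], symmetric in its two arguments, is [t ^+ 2 * H k l]
   up to [e / 2 * t ^+ 2]. *)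
pose D (k l : 'I_m) := phi (y + E k + E l) - phi (y + E k) - phi (y + E l) + phi y.
have DE k l : `|D k l - t ^+ 2 * H k l| <= e / 2 * t ^+ 2.
  (* [D k l] is an increment of [f] along [E l]. The mean value theorem turns it into an increment
     of the gradient along [E k], which strict differentiability compares with [E k *m H]; both
     points stay within 2 t < d of [y]. *)
  pose f z := phi (z + E k) - phi z.
  have df z u : derivable f z u /\ 'D_u f z = 'D_u phi (z + E k) - 'D_u phi z.
    have Eq : (fun h : R => h^-1 *: (((fun z => phi (z + E k)) \o shift z) (h *: u) -
        phi (z + E k))) = (fun h => h^-1 *: ((phi \o shift (z + E k)) (h *: u) - phi (z + E k))).
      by apply/funext => h /=; rewrite addrA.
    have dz w : derivable phi w u by exact: diff_derivable.
    have dk : derivable (fun z => phi (z + E k)) z u.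
      by rewrite /derivable Eq; exact: dz.
    have Dk : 'D_u (fun z => phi (z + E k)) z = 'D_u phi (z + E k) by rewrite /derive Eq.
    by split; [exact: derivableB dk (dz z) | rewrite -Dk; exact: deriveB dk (dz z)].
  have [t' /andP[t'0 t'1] Ef] : exists2 t' : R, 0 < t' < 1 & f (y + E l) - f y = 'D_(E l) f (y + t' *: E l).
    by apply: mean_value_line => s _; exact: (df _ _).1.
  set z := y + t' *: E l in Ef.
  have -> : D k l = 'D_(E l) f z.
    by rewrite -Ef /D /f [y + E l + E k]addrAC; ring.
  rewrite (df _ _).2 !derive_gradient -sumrB (bigD1 l) //= big1 => [|l' l'l]; last first.
    by rewrite -mulrBl /E !mxE eqxx (negPf l'l) !mulr0.
  rewrite addr0 -mulrBl /E !mxE eqxx eqxx mulr1 -/(E k) -/(E l).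
  have zd : `|z - y| <= t.
    rewrite /z addrAC subrr add0r normrZ gtr0_norm //.
    by rewrite (le_trans _ (Et l)) // ler_piMl // ltW.
  have := dP (z + E k) z; rewrite [z + E k - z]addrAC subrr add0r => dPz.
  have {dPz} : `|gradient phi (z + E k) - gradient phi z - E k *m H| <= e / 2 * t.
    apply: (le_trans (dPz _ _)); last by rewrite ler_wpM2l // divr_ge0 // ltW.
      rewrite addrAC (le_lt_trans (ler_normD _ _)) // (le_lt_trans (lerD zd (Et k))) //.
      by rewrite /t; lra.
    by rewrite (le_lt_trans zd) // /t; lra.
  move=> /(le_trans (norm_entry_le _ l)).
  have -> : (gradient phi (z + E k) - gradient phi z - E k *m H) 0 l =
     partial l phi (z + E k) - partial l phi z - t * H k l.
    by rewrite /E -scalemxAl -rowE !mxE.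
  set a := partial l phi _ - _ => ha.
  have Hkl : H k l = partial k (partial l phi) y by rewrite mxE.
  rewrite -Hkl; have -> : a * t - t ^+ 2 * H k l = (a - t * H k l) * t by ring.
  by rewrite normrM (gtr0_norm t0) expr2 [leRHS]mulrA ler_wpM2r // ltW.
have Dsym : D i j = D j i by rewrite /D [y + E i + E j]addrAC; ring.
have h1 := DE i j; have h2 := DE j i; rewrite Dsym in h1.
have : t ^+ 2 * `|H j i - H i j| <= t ^+ 2 * e.
  have -> : t ^+ 2 * `|H j i - H i j| = `|(D j i - t ^+ 2 * H i j) - (D j i - t ^+ 2 * H j i)|.
    rewrite -{1}[t ^+ 2]gtr0_norm ?exprn_gt0 // -normrM; congr `|_|; ring.
  by rewrite (le_trans (ler_normB _ _)) // (le_trans (lerD h1 h2)) // le_eqVlt; apply/orP; left; apply/eqP; field.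
by rewrite ler_pM2l // exprn_gt0.
Qed.

(* Mean value theorem along [y, y + h], the gradient being linearised at y. *)
Lemma second_order_expansion y e : crit phi y -> 0 < e ->
  exists2 d, 0 < d & forall h, `|h| < d -> exists2 t, 0 < t &
    `|phi (y + h) - phi y - t * bil (hessian phi y) h h| <= t * (e * `|h| ^+ 2).
Proof.
move=> cy e0; have m0 : 0 < 1 + m%:R :> R by rewrite ltr_pwDl.
have [|d d0 dP] := strict_differentiability grad_diff grad_C1 y (e := e / (1 + m%:R)).
  by rewrite divr_gt0.
exists d => // h hd; have [t /andP[t0 t1] E] : exists2 t : R, 0 < t < 1 &
    phi (y + h) - phi y = 'D_h phi (y + t *: h).
  by apply: mean_value_line => s _; exact: diff_derivable.
exists t => //; rewrite E derive_gradient.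
have td : `|t *: h| < d.
  by rewrite normrZ gtr0_norm // (le_lt_trans _ hd) // ler_piMl // ltW.
have := dP (y + t *: h) y; rewrite [y + t *: h - y]addrAC subrr add0r normr0 jac_gradient.
move=> /(_ td d0); rewrite (cy : gradient phi y = 0) subr0.
set G := gradient phi _; set H := hessian phi y; rewrite -scalemxAl => GH.
have -> : \sum_j G 0 j * h 0 j - t * bil H h h = \sum_j (G - t *: (h *m H)) 0 j * h 0 j.
  rewrite /bil mulr_sumr -sumrB; apply: eq_bigr => j _.
  by rewrite mulrA -mulrBl; congr (_ * _); rewrite !mxE.
rewrite (le_trans (dot_bound _ _)) //.
rewrite (@le_trans _ _ (m%:R * ((e / (1 + m%:R) * `|t *: h|) * `|h|))) //.
  by rewrite ler_wpM2l // ler_wpM2r.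
rewrite normrZ gtr0_norm //.
have -> : m%:R * (e / (1 + m%:R) * (t * `|h|) * `|h|) = (m%:R / (1 + m%:R)) * (t * (e * `|h| ^+ 2)).
  by field; rewrite gt_eqF.
rewrite ler_piMl ?mulr_ge0 ?exprn_ge0 ?(ltW t0) ?(ltW e0) //.
by rewrite ler_pdivrMr // mul1r lerDr.
Qed.

Lemma local_minimizer_crit y : local_minimizer phi y -> crit phi y.
Proof.
move=> /nbhs_normP[d1 d10 d1P]; apply/rowP => i; rewrite [RHS]mxE.
apply: contrapT => /eqP D0; set D := gradient phi y 0 i in D0.
have D1 : 0 < `|D| by rewrite normr_gt0.
have [|d d0 dP] := differentiable_bound (phi_diff y) (e := `|D| / 2).
  by rewrite divr_gt0.
(* The step [h] below goes against the i-th partial derivative, with length at most min(d, d1) / 2.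
   The linear term is - t D^2, and the error at most half of it in absolute value. *)
pose t := Num.min d d1 / (2 * `|D|).
have dd0 : 0 < Num.min d d1 by rewrite lt_min d0.
have t0 : 0 < t by rewrite divr_gt0 // mulr_gt0.
pose h : 'rV[R]_m := (- (t * D)) *: delta_mx 0 i.
have hn : `|h| <= t * `|D|.
  apply: norm_row_le => [|k]; first by rewrite mulr_ge0 // ltW.
  rewrite !mxE eqxx /=; case: eqP => _; last by rewrite mulr0 normr0 mulr_ge0 // ltW.
  by rewrite mulr1 normrN normrM gtr0_norm.
have hd : `|h| < Num.min d d1.
  apply: (le_lt_trans hn); rewrite /t invfM mulrA -mulrA mulVf ?gt_eqF // mulr1.
  by rewrite ltr_pdivrMr // ltr_pMr // ltr1n.
move: (hd); rewrite lt_min => /andP[hd' hd1]; have := dP h hd'.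
have := d1P (y + h); rewrite addrAC subrr add0r => /(_ hd1) min.
have -> : 'D_h phi y = - (t * D * D).
  rewrite derive_gradient (bigD1 i) //= big1 => [|k ki]; last first.
    by rewrite !mxE (negPf ki) !mulr0.
  rewrite addr0 -/D; have -> : h 0 i = - (t * D) by rewrite !mxE !eqxx mulr1.
  by rewrite mulrN mulrC.
move=> /(le_trans (ler_norm _)) ineq.
have : t * `|D| ^+ 2 <= 2^-1 * (t * `|D| ^+ 2).
  rewrite real_normK ?num_real // expr2.
  have : `|D| / 2 * `|h| <= `|D| / 2 * (t * `|D|) by rewrite ler_wpM2l // divr_ge0.
  have -> : `|D| / 2 * (t * `|D|) = 2^-1 * (t * (`|D| ^+ 2)) by field.
  rewrite real_normK ?num_real // expr2 => le2; lra.
have : 0 < t * `|D| ^+ 2 by rewrite mulr_gt0 // exprn_gt0.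
lra.
Qed.

Lemma local_minimizer_psd y : local_minimizer phi y -> psd (hessian phi y).
Proof.
move=> lm v; have cy := local_minimizer_crit lm; move: lm => /nbhs_normP[d1 d10 d1P].
rewrite leNgt; apply/negP => q0; set q := bil _ v v in q0.
have v0 : 0 < `|v|.
  rewrite normr_gt0; apply: contraTneq q0 => v0; rewrite -leNgt /q v0.
  by rewrite /bil big1 // => j _; rewrite [X in _ * X]mxE mulr0.
(* With this [e], the error along [v] is at most half of the negative quadratic term. *)
have e0 : 0 < - q / (2 * `|v| ^+ 2) by rewrite divr_gt0 ?oppr_gt0 // mulr_gt0 // exprn_gt0.
have [d d0 dP] := second_order_expansion cy e0.
have dd0 : 0 < Num.min d d1 by rewrite lt_min d0.
pose s := Num.min d d1 / (2 * `|v|); have s0 : 0 < s by rewrite divr_gt0 // mulr_gt0.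
have hd : `|s *: v| < Num.min d d1.
  rewrite normrZ (gtr0_norm s0); have -> : s * `|v| = Num.min d d1 / 2.
    by rewrite /s; field; rewrite gt_eqF.
  by rewrite ltr_pdivrMr // ltr_pMr // ltr1n.
move: hd; rewrite lt_min => /andP[/dP[t t0 H] hd1].
have := d1P (y + s *: v); rewrite addrAC subrr add0r => /(_ hd1) min.
move: H; rewrite bilZl bilZr -/q normrZ gtr0_norm // exprMn => /(le_trans (ler_norm _)).
have -> : - q / (2 * `|v| ^+ 2) * (s ^+ 2 * `|v| ^+ 2) = - (s * (s * q)) / 2.
  by field; rewrite gt_eqF.
have : 0 < t * - (s * (s * q)) by rewrite mulr_gt0 // oppr_gt0 !pmulr_rlt0.
lra.
Qed.

(** Expanding with precision [c] suffices, since coercivity makes the quadratic term at least as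
    large as the error. *)
Lemma coercive_local_minimizer y c : crit phi y -> 0 < c ->
  (forall v, c * `|v| ^+ 2 <= bil (hessian phi y) v v) -> local_minimizer phi y.
Proof.
move=> cy c0 cH; have [d d0 dP] := second_order_expansion cy c0.
apply/nbhs_normP; exists d => // z zd; have [t t0] := dP _ zd.
rewrite [y + (z - y)]addrC subrK ler_norml => /andP[H _].
have : t * (c * `|z - y| ^+ 2) <= t * bil (hessian phi y) (z - y) (z - y) by rewrite ler_pM2l.
move: H; lra.
Qed.

Lemma Morse_local_minimizerP y : hessian phi y \in unitmx ->
  local_minimizer phi y <-> crit phi y /\ psd (hessian phi y).
Proof.
move=> uH; split=> [lm|[cy pH]].
  by split; [exact: local_minimizer_crit | exact: local_minimizer_psd].
have [c c0 cH] := psd_coercive (hessian_sym y) uH pH.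
exact: coercive_local_minimizer cy c0 cH.
Qed.

End LocalMinimizers.

(** * The sheets of the critical set *)

Section HessianAlongSection.
Variables (R : realType) (n m : nat) (H : 'rV[R]_n -> 'M[R]_m).
Hypothesis H_continuous : forall i j, continuous (fun x => H x i j).
Hypothesis H_sym : forall x, (H x)^T = H x.
Hypothesis H_unit : forall x, H x \in unitmx.

(** Semidefiniteness is open because an invertible semidefinite form is coercive; its failure is
    open because a negative value at a fixed [v] persists. *)
Lemma psd_connected x x' : psd (H x) -> psd (H x').
Proof.
have close x1 e : 0 < e -> exists2 d, 0 < d & forall x2, `|x2 - x1| < d ->
    forall v, `|bil (H x2) v v - bil (H x1) v v| <= e * `|v| ^+ 2.
  move=> e0; pose e' := e / (1 + m%:R * m%:R).
  have m0 : 0 < 1 + m%:R * m%:R :> R by rewrite ltr_pwDl // mulr_ge0.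
  have e'0 : 0 < e' by rewrite divr_gt0.
  have : \forall x2 \near x1, forall ij : 'I_m * 'I_m,
      `|H x2 ij.1 ij.2 - H x1 ij.1 ij.2| <= e'.
    apply: (@filter_forall _ _ (fun ij x2 => `|H x2 ij.1 ij.2 - H x1 ij.1 ij.2| <= e') (nbhs x1)).
    move=> -[i j] /=; have /cvgrPdist_le/(_ _ e'0) := @H_continuous i j x1.
    by apply: filterS => x2; rewrite distrC.
  move=> /nbhs_normP[d d0 dP]; exists d => // x2 /dP close v.
  apply: (le_trans (bil_perturb v (fun i j => close (i, j)))); rewrite ler_wpM2r ?exprn_ge0 //.
  by rewrite mulrA /e' mulrA ler_pdivrMr // [leRHS]mulrC ler_wpM2r ?(ltW e0) // lerDr.
move=> px; apply: (clopen_segment_closed (A := setT) (P := fun x => psd (H x)) _ _ _ (I : setT x) px) => //.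
- move=> x1 _ p1; have [c c0 cP] := psd_coercive (H_sym x1) (H_unit x1) p1.
  have [d d0 dP] := close x1 c c0; exists d => // x2 _ /dP x2d v.
  by have := x2d v; have := cP v; rewrite ler_norml => h1 /andP[h2 _]; lra.
- move=> x1 _ /existsNP[v /negP]; rewrite -ltNge => v0.
  have v1 : 0 < 1 + `|v| ^+ 2 by rewrite ltr_pwDl // exprn_ge0.
  pose e := - bil (H x1) v v / (1 + `|v| ^+ 2).
  have [|d d0 dP] := close x1 e; first by rewrite divr_gt0 // oppr_gt0.
  exists d => // x2 _ /dP /(_ v); rewrite ler_norml => /andP[_ h2] /(_ v) p2.
  have : e * `|v| ^+ 2 < - bil (H x1) v v.
    by rewrite /e mulrAC ltr_pdivrMr // ltr_pM2l ?oppr_gt0 // ltrDr.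
  lra.
Qed.

End HessianAlongSection.

Section Slices.
Variables (R : realType) (n m : nat).

Lemma derive_slice (f : 'rV[R]_(n + m) -> R) x y (i : 'I_m) :
  partial i (slice f x) y = 'D_(delta_mx 0 (rshift n i)) f (row_mx x y).
Proof.
have E : delta_mx 0 (rshift n i) = row_mx 0 (delta_mx 0 i) :> 'rV[R]_(n + m).
  apply/rowP => l; rewrite !mxE eqxx /=; case: splitP => l' ll'; rewrite mxE.
    by case: eqP => // /(congr1 val) /=; rewrite ll' => lE; have := ltn_ord l'; rewrite lE ltnNge leq_addr.
  by rewrite eqxx /= -[l == _]val_eqE /= ll' eqn_add2l.
have Eq : (fun h : R => h^-1 *: ((slice f x \o shift y) (h *: delta_mx 0 i) - slice f x y)) =
    (fun h => h^-1 *: ((f \o shift (row_mx x y)) (h *: delta_mx 0 (rshift n i)) - f (row_mx x y))).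
  by apply/funext => h; rewrite /= /slice E scale_row_mx scaler0 add_row_mx add0r.
by rewrite /partial /derive Eq.
Qed.

Variable g : 'rV[R]_(n + m) -> R.

Definition fibre_gradient (w : 'rV[R]_(n + m)) : 'rV[R]_m :=
  \row_j 'D_(delta_mx 0 (rshift n j)) g w.

Lemma gradient_slice x y : gradient (slice g x) y = fibre_gradient (row_mx x y).
Proof. by apply/rowP => i; rewrite !mxE derive_slice. Qed.

Lemma crit_slice x y : crit (slice g x) y = zeros fibre_gradient x y.
Proof. by rewrite /crit /zeros /= gradient_slice. Qed.

(** Through this identity the Morse condition becomes the regularity hypothesis of the implicit
    function theorem. *)
Lemma hessian_slice x y : hessian (slice g x) y = dsubmx (jac fibre_gradient (row_mx x y)).
Proof.
apply/matrixP => i j; rewrite !mxE.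
rewrite (_ : partial j (slice g x) = slice (fun w => fibre_gradient w 0 j) x).
  by rewrite derive_slice.
by apply/funext => z; rewrite derive_slice /slice mxE.
Qed.

End Slices.

Theorem proposition3p6 (R : realType) (n m k : nat) (hk : (1 < k)%N)
    (g : 'rV[R]_(n + m) -> R)
    (g_semialgebraic : semialgebraic_fun g)
    (g_Ck : class_C k g)
    (g_Morse : parametric_Morse g)
    (crit_nonempty : forall x : 'rV[R]_n, crit (slice g x) !=set0)
    (crit_locally_bounded :
      locally_bounded (fun x : 'rV[R]_n => crit (slice g x))) :
  exists (M N : nat) (y : 'I_M -> 'rV[R]_n -> 'rV[R]_m),
    [/\ (N <= M)%N,
        forall i, semialgebraic_map (y i) /\ class_C (k - 1) (y i),
        forall x i j, i <> j -> y i x <> y j x,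
        [set xy : 'rV[R]_n * 'rV[R]_m | crit (slice g xy.1) xy.2] =
          \bigcup_(i in [set: 'I_M]) graph (y i) &
        [set xy : 'rV[R]_n * 'rV[R]_m | local_minimizer (slice g xy.1) xy.2] =
          \bigcup_(i in [set i : 'I_M | (i < N)%N]) graph (y i)].
Proof.
case: k hk g_Ck => [|[|K]] // _ g_Ck; rewrite subn1 /=.
pose F := fibre_gradient g; pose Z := zeros F.
have FE j : (fun w => F w 0 j) = 'D_(delta_mx 0 (rshift n j)) g.
  by apply/funext => w; rewrite mxE.
have F_CK j : class_C K.+1 (fun w => F w 0 j) by rewrite FE; exact: g_Ck.2.
have dF j w : differentiable (fun w => F w 0 j) w by exact: (F_CK j).1.
have CF j u : continuous (fun w => 'D_u (fun w => F w 0 j) w).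
  by have := (F_CK j).2 u; apply: (@class_C_le _ _ _ 0 K).
have slice_C2 x : class_C 2 (slice g x) by exact: (g_Morse.2 x).1.
have hess_unit x v : Z x v -> hessian (slice g x) v \in unitmx.
  by move=> Zv; apply: (g_Morse.2 x).2; rewrite crit_slice.
have F_regular x v : Z x v -> dsubmx (jac F (row_mx x v)) \in unitmx.
  by move=> /hess_unit; rewrite hessian_slice.
have Z_unique x0 v0 := @zeros_locally_unique R n m F dF CF F_regular x0 v0.
have Z_exist x0 v0 r := @zeros_locally_exist R n m F dF CF F_regular x0 v0 r.
have Z_closed x v := @zeros_closed R n m F dF x v.
have critE : (fun x => crit (slice g x)) = Z.
  by apply/funext => x; apply/funext => v; exact: crit_slice.
have Z_bounded : locally_bounded Z by rewrite -critE.
have lmE x v : Z x v -> local_minimizer (slice g x) v <-> psd (hessian (slice g x) v).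
  move=> Zv; have lmP := Morse_local_minimizerP (slice_C2 x) (hess_unit _ _ Zv).
  by split=> [/lmP[]//|pv]; apply/lmP; rewrite crit_slice.
have /finite_seqP[L LE] := finite_fibre Z_unique Z_closed Z_bounded 0.
have /choice[f fP] : forall p, exists s : 'rV[R]_n -> 'rV[R]_m,
    Z 0 p -> [/\ s 0 = p, continuous s & forall x, Z x (s x)].
  move=> p; have [Zp|nZp] := pselect (Z 0 p); last by exists (fun=> 0).
  by have [s sP] := global_section Z_unique Z_exist Z_closed Z_bounded Zp; exists s.
(* Sheets are numbered by the points of the fibre over 0, local minimizers first, so that [i < N]
   singles out the minimizing sheets. *)
pose isloc p := `[< local_minimizer (slice g 0) p >].
pose L1 := [seq p <- undup L | isloc p]; pose L2 := [seq p <- undup L | ~~ isloc p].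
pose P := L1 ++ L2; pose M := size P; pose N := size L1.
have Puniq : uniq P.
  rewrite cat_uniq !filter_uniq ?undup_uniq // andbT /=; apply/hasPn => p.
  by rewrite !mem_filter => /andP[/negPf->].
have PZ p : p \in P <-> Z 0 p.
  rewrite /Z LE /= /P mem_cat !mem_filter mem_undup.
  by case: (isloc p) => /=; rewrite ?orbF.
pose y (i : 'I_M) := f (nth 0 P i).
have yP i : [/\ y i 0 = nth 0 P i, continuous (y i) & forall x, Z x (y i x)].
  by apply: fP; apply/PZ; apply: mem_nth.
have ycont i : continuous (y i) by have [] := yP i.
have yZ i x : Z x (y i x) by have [] := yP i.
have y0 i : y i 0 = nth 0 P i by have [] := yP i.
have yuniq s s' x : continuous s -> continuous s' -> (forall x, Z x (s x)) ->
    (forall x, Z x (s' x)) -> s x = s' x -> s = s'.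
  exact: (global_section_unique Z_unique).
have ydist x i j : i <> j -> y i x <> y j x.
  move=> ij yij; apply: ij; have E : y i = y j by apply: yuniq yij.
  apply: val_inj; apply/eqP; rewrite -(nth_uniq 0 (ltn_ord i) (ltn_ord j) Puniq).
  by rewrite -!y0 E.
have ycover : forall x v, Z x v <-> exists i, v = y i x.
  move=> x v; split=> [Zv|[i ->]//].
  (* The section through (x, v) is followed back to 0, where its value determines the index of its
     sheet. *)
  have [s [sv cs Zs]] := global_section Z_unique Z_exist Z_closed Z_bounded Zv.
  have /PZ sP := Zs 0; have iM : (index (s 0%R) P < M)%N by rewrite index_mem.
  have E : s = y (Ordinal iM) by apply: (@yuniq _ _ 0) => //; rewrite y0 /= nth_index.
  by exists (Ordinal iM); rewrite -E.
have Z_sa : semialgebraic_set (fun w : 'rV_(n + m) => Z (lsubmx w) (rsubmx w)).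
  rewrite -critE; apply: sa_crit => // x v; exact: (slice_C2 x).1.
have y0N i : local_minimizer (slice g 0) (y i 0) <-> (i < N)%N.
  rewrite y0 nth_cat -/N; case: ltnP => iN.
    split=> // _; apply/asboolP; have : nth 0 L1 i \in L1 by exact: mem_nth.
    by rewrite mem_filter => /andP[].
  split=> // lm; have : nth 0 L2 (i - N) \in L2.
    by apply: mem_nth; rewrite ltn_subLR // -size_cat.
  by rewrite mem_filter => /andP[/negP[]]; apply/asboolP.
have yN i x : local_minimizer (slice g x) (y i x) <-> (i < N)%N.
  pose H x := hessian (slice g x) (y i x).
  have Hc a b : continuous (fun x => H x a b).
    have cg : class_C 0 (fun x => row_mx x (y i x)) by apply: class_C_row_mx; exact: ycont.
    have : class_C 0 (fun x => jac F (row_mx x (y i x)) (rshift n a) b).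
      under eq_fun do rewrite mxE.
      by apply: (@class_C_comp _ _ _ _ ('D_(delta_mx 0 (rshift n a)) (fun w => F w 0 b)) _ _ cg).
    by apply: class_C_ext => z; rewrite /H hessian_slice !mxE.
  have Hs z : (H z)^T = H z by exact: hessian_sym.
  have Hu z : H z \in unitmx by exact: hess_unit.
  rewrite -y0N (lmE x _ (yZ i x)) (lmE 0 _ (yZ i 0)).
  have pE a b : psd (H a) -> psd (H b) by exact: psd_connected.
  by split; [exact: (pE x 0) | exact: (pE 0 x)].
exists M, N, y; split=> //.
- by rewrite /M size_cat leq_addr.
- move=> i; split; first exact: (sheet_semialgebraic Z_sa ycont ydist ycover).
  exact: (@section_class_C R n m K F F_CK F_regular (y i) (ycont i) (yZ i)).
- apply/seteqP; split=> [[x v] /=|[x v] [i _ vi]] /=; rewrite crit_slice.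
    by move=> /ycover[i vi]; exists i.
  by apply/ycover; exists i.
- apply/seteqP; split=> [[x v] /= lm|[x v] [i /= iN vi]] /=; last first.
    by have -> : v = y i x := vi; exact/yN.
  have /ycover[i vi] : Z x v.
    by rewrite -critE; apply: local_minimizer_crit lm; exact: slice_C2.
  by exists i; [apply/(yN i x); rewrite -vi | exact: vi].
Qed.
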